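(* Let $I$ and $J$ be disjoint index sets. For any two series $f$ and $g$ in $\mathbb{C}_0\langle\!\langle z_k:k\in I\sqcup J\rangle\!\rangle$, $$\mathrm{bReta}(f\,\widetilde{\star}\,g)=\mathrm{bReta}(f)\,\widetilde{\star}\,\mathrm{bReta}(g).$$
   Context: For $\chi:\{1,\dots,n\}\to\{\ell,r\}$ with $\chi^{-1}(\{\ell\})=\{i_1<\cdots<i_p\}$ and $\chi^{-1}(\{r\})=\{i_{p+1}>\cdots>i_n\}$, let $s_\chi$ be the permutation $s_\chi(j)=i_j$ of $\{1,\dots,n\}$ and $\prec_\chi$ the total order $i_1\prec_\chi\cdots\prec_\chi i_n$. $\mathrm{BNC}(\chi)$ is the set of partitions $\pi$ of $\{1,\dots,n\}$ non-crossing with respect to $\prec_\chi$ (equivalently $s_\chi^{-1}\cdot\pi$, obtained by applying $s_\chi^{-1}$ to the blocks, is non-crossing); $\mathrm{BI}(\chi)$ is the set of partitions all of whose blocks are intervals for $\prec_\chi$. $K_{\mathrm{NC}}$ is the usual Kreweras complementation map on non-crossing partitions of $\{1,\dots,n\}$ ($K_{\mathrm{NC}}(\pi)$ is the largest partition $\sigma$ of $\{\bar1,\dots,\bar n\}$, identified with $\{1,\dots,n\}$, such that $\pi\cup\sigma$ is non-crossing for the order $1<\bar1<2<\bar2<\cdots<n<\bar n$), and $K_{\mathrm{BNC}}(\pi)=s_\chi\cdot K_{\mathrm{NC}}(s_\chi^{-1}\cdot\pi)$ for $\pi\in\mathrm{BNC}(\chi)$. For $V=\{v_1<\cdots<v_s\}$,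 $(x_1,\dots,x_n)|_V=(x_{v_1},\dots,x_{v_s})$ and $\chi|_V$ is regarded as a map on $\{1,\dots,s\}$. For $\alpha:\{1,\dots,n\}\to I\sqcup J$, $\chi_\alpha(k)=\ell$ if $\alpha(k)\in I$ and $\chi_\alpha(k)=r$ if $\alpha(k)\in J$. $\mathbb{C}_0\langle\!\langle z_k:k\in I\sqcup J\rangle\!\rangle$ is the set of formal power series with complex coefficients and zero constant term in non-commuting indeterminates $z_k$. $\mathrm{Cf}_{(\alpha(1),\dots,\alpha(n))}(f)$ is the coefficient of $z_{\alpha(1)}\cdots z_{\alpha(n)}$ in $f$, and $\mathrm{Cf}_{(\alpha(1),\dots,\alpha(n));\pi}(f)=\prod_{V\in\pi}\mathrm{Cf}_{(\alpha(1),\dots,\alpha(n))|_V}(f)$. The series $f\,\widetilde\star\,g$ is defined by $$\mathrm{Cf}_{(\alpha(1),\dots,\alpha(n))}(f\,\widetilde\star\,g)=\sum_{\pi\in\mathrm{BNC}(\chi_\alpha)}\mathrm{Cf}_{(\alpha(1),\dots,\alpha(n));\pi}(f)\cdot\mathrm{Cf}_{(\alpha(1),\dots,\alpha(n));K_{\mathrm{BNC}}(\pi)}(g)$$ for all $n\ge1$ and $\alpha:\{1,\dots,n\}\to I\sqcup J$. For a unital algebra $\mathcal{A}$ with unital linear functional $\varphi$, the $(\ell,r)$-cumulants $\kappa_\chi$ and B-$(\ell,r)$-cumulants $B_\chi$ are the unique multilinear functionals $\mathcal{A}^n\to\mathbb{C}$ with $\varphi(x_1\cdots x_n)=\sum_{\pi\in\mathrm{BNC}(\chi)}\prod_{V\in\pi}\kappa_{\chi|_V}((x_1,\dots,x_n)|_V)=\sum_{\pi\in\mathrm{BI}(\chi)}\prod_{V\in\pi}B_{\chi|_V}((x_1,\dots,x_n)|_V)$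 for all $n\geq 1,\chi,x_j$. $\mathcal{D}_{\mathrm{alg}}(I\sqcup J)$ is the set of unital linear functionals $\mu:\mathbb{C}\langle Z_k:k\in I\sqcup J\rangle\to\mathbb{C}$. For such $\mu$ (with cumulants taken with respect to $\mu$), $\mathcal{R}_\mu$ and $\eta_\mu$ are the series in $\mathbb{C}_0\langle\!\langle z_k\rangle\!\rangle$ whose coefficients of $z_{\alpha(1)}\cdots z_{\alpha(n)}$ are $\kappa_{\chi_\alpha}(Z_{\alpha(1)},\dots,Z_{\alpha(n)})$ and $B_{\chi_\alpha}(Z_{\alpha(1)},\dots,Z_{\alpha(n)})$ respectively. The maps $\mathcal{R},\eta:\mathcal{D}_{\mathrm{alg}}(I\sqcup J)\to\mathbb{C}_0\langle\!\langle z_k\rangle\!\rangle$ are bijections, and $\mathrm{bReta}=\eta\circ\mathcal{R}^{-1}$. *)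

(* Defs.v *)
From HB Require Import structures.
From mathcomp Require Import all_boot all_order all_fingroup all_algebra.
From mathcomp Require Import complex reals finmap.
From mathcomp Require Export monalg.
From Stdlib Require Import FunctionalExtensionality ClassicalEpsilon ProofIrrelevance.

Set Implicit Arguments.
Unset Strict Implicit.
Unset Printing Implicit Defensive.

Import Order.TTheory GRing.Theory Num.Theory.
Local Open Scope ring_scope.

(* The indices 1, ..., n are rendered as 0, ..., n - 1, i.e. as 'I_n. *)

(* lft stands for l and rgt for r. *)
Notation side := bool (only parsing).
Notation lft := true (only parsing).
Notation rgt := false (only parsing).

(* x|_V: the entries of x at the elements of V, in increasing order. *)
Definition restr (T : Type) (n : nat) (V : {set 'I_n}) (x : n.-tuple T) :
    #|V|.-tuple T :=
  [tuple tnth x (enum_val i) | i < #|V|].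

Lemma restr_full (T1 T2 U : Type) (F : forall n, n.-tuple T1 -> n.-tuple T2 -> U)
    n (chi : n.-tuple T1) (x : n.-tuple T2) :
  F #|[set: 'I_n]| (restr [set: 'I_n] chi) (restr [set: 'I_n] x) = F n chi x.
Proof.
have val_restr (T : Type) k (t : k.-tuple T) :
    restr [set: 'I_k] t = t :> seq T.
  case: k t => [|k] t.
    by rewrite (tuple0 t); apply: size0nil; rewrite size_tuple cardsT card_ord.
  have ltk i : (i < #|[set: 'I_k.+1]|)%N -> (i < k.+1)%N.
    by rewrite cardsT card_ord.
  apply: (@eq_from_nth _ (tnth t ord0)).
    by rewrite !size_tuple cardsT card_ord.
  move=> i; rewrite size_tuple => lti.
  have -> := esym (tnth_nth (tnth t ord0) (restr _ t) (Ordinal lti)).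
  rewrite tnth_mktuple (tnth_nth (tnth t ord0)); congr nth.
  by rewrite (enum_val_nth ord0) /= enum_setT -enumT nth_enum_ord // ltk.
have eqn : #|[set: 'I_n]| = n by rewrite cardsT card_ord.
move: (restr _ chi) (restr _ x) (val_restr _ _ chi) (val_restr _ _ x).
move: #|_| eqn => m eqm; case: n / eqm chi x => chi x c y ec ey.
by congr F; apply: val_inj.
Qed.

Section Partitions.

Definition act_part (n : nat) (s : 'S_n) (P : {set {set 'I_n}}) :
    {set {set 'I_n}} :=
  [set [set s i | i in V] | V : {set 'I_n} in P].

Definition refines (T : finType) (P Q : {set {set T}}) : bool :=
  [forall V in P, [exists W in Q, V \subset W]].

Definition noncrossing (T : finType) (lt : rel T) (P : {set {set T}}) : bool :=
  [forall V in P, [forall W in P, (V != W) ==>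
    [forall a in V, [forall b in W, [forall c in V, [forall d in W,
       ~~ [&& lt a b, lt b c & lt c d]]]]]]].

Definition interval_blocks (T : finType) (lt : rel T) (P : {set {set T}}) :
    bool :=
  [forall V in P, [forall a in V, [forall c in V, [forall b : T,
     (lt a b && lt b c) ==> (b \in V)]]]].

Definition NC (n : nat) : {set {set {set 'I_n}}} :=
  [set P | partition P [set: 'I_n]
         & noncrossing (fun i j : 'I_n => (i < j)%N) P].

(* The disjoint union of two copies of 'I_n, ordered as
   0 < bar 0 < 1 < bar 1 < ..., with i = inl i and bar i = inr i. *)
Definition bar_pos (n : nat) (u : 'I_n + 'I_n) : nat :=
  match u with inl i => i.*2 | inr i => i.*2.+1 end.

Definition bar_union (n : nat) (P Q : {set {set 'I_n}}) :
    {set {set ('I_n + 'I_n)%type}} :=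
  [set [set inl i | i in V] | V : {set 'I_n} in P]
    :|: [set [set inr i | i in W] | W : {set 'I_n} in Q].

Definition kreweras_compatible (n : nat) (P Q : {set {set 'I_n}}) : bool :=
  partition Q [set: 'I_n] &&
  noncrossing (fun u v : 'I_n + 'I_n => (bar_pos u < bar_pos v)%N)
    (bar_union P Q).

(* The largest compatible partition; it exists whenever P is in NC n, and the
   default value P is only reached outside NC n. *)
Definition K_NC (n : nat) (P : {set {set 'I_n}}) : {set {set 'I_n}} :=
  odflt P [pick Q : {set {set 'I_n}} | kreweras_compatible P Q &&
    [forall Q' : {set {set 'I_n}}, kreweras_compatible P Q' ==> refines Q' Q]].

Variables (n : nat) (chi : n.-tuple side).

(* i_1, ..., i_n: the left indices increasing, then the right ones decreasing. *)
Definition s_seq : seq 'I_n :=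
  [seq i <- enum 'I_n | tnth chi i == lft]
    ++ rev [seq i <- enum 'I_n | tnth chi i == rgt].

Lemma s_seq_perm : perm_eq s_seq (enum 'I_n).
Proof.
have e : predC (fun i => tnth chi i == lft) =1 (fun i => tnth chi i == rgt).
  by move=> i /=; case: (tnth chi i).
rewrite /s_seq -(eq_filter e).
apply: (@perm_trans _ ([seq i <- enum 'I_n | tnth chi i == lft]
  ++ [seq i <- enum 'I_n | predC (fun i => tnth chi i == lft) i])).
  by rewrite perm_cat2l perm_rev.
by rewrite perm_filterC.
Qed.

Lemma size_s_seq : size s_seq == n.
Proof. by rewrite (perm_size s_seq_perm) size_enum_ord. Qed.

Lemma s_fun_inj : injective (tnth (Tuple size_s_seq)).
Proof.
apply/tuple_uniqP; rewrite (perm_uniq s_seq_perm); exact: enum_uniq.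
Qed.

Definition s_perm : 'S_n := perm s_fun_inj.

Definition prec : rel 'I_n :=
  fun i j => (index i s_seq < index j s_seq)%N.

Definition BNC : {set {set {set 'I_n}}} :=
  [set P | partition P [set: 'I_n] & noncrossing prec P].

Definition BI : {set {set {set 'I_n}}} :=
  [set P | partition P [set: 'I_n] & interval_blocks prec P].

Definition K_BNC (P : {set {set 'I_n}}) : {set {set 'I_n}} :=
  act_part s_perm (K_NC (act_part s_perm^-1%g P)).

End Partitions.

Section Cumulants.

Variables (C : comNzRingType) (A : algType C).

Definition set_entry (n : nat) (x : n.-tuple A) (i : 'I_n) (u : A) :
    n.-tuple A :=
  [tuple if j == i then u else tnth x j | j < n].

Definition multilinear (n : nat) (F : n.-tuple A -> C) : Prop :=
  forall (x : n.-tuple A) (i : 'I_n), scalar (fun u => F (set_entry x i u)).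

Definition functional_family : Type :=
  forall n : nat, n.-tuple side -> n.-tuple A -> C.

(* There are no cumulants of order 0; the entry n = 0 of a family is
   set to 0 so that the family is unique. *)
Definition is_cumulants (S : forall n, n.-tuple side -> {set {set {set 'I_n}}})
    (phi : {scalar A}) (kappa : functional_family) : Prop :=
  [/\ forall (chi : 0.-tuple side) (x : 0.-tuple A), kappa 0%N chi x = 0,
      forall (n : nat) (chi : n.-tuple side), multilinear (kappa n chi)
    & forall (n : nat) (chi : n.-tuple side) (x : n.-tuple A), (0 < n)%N ->
        phi (\prod_(i < n) tnth x i) =
        \sum_(P in S n chi)
          \prod_(V in P) kappa #|V| (restr V chi) (restr V x)].

Section Existence.

Variable S : forall n, n.-tuple side -> {set {set {set 'I_n}}}.
Hypothesis S_partition : forall n (chi : n.-tuple side) P,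
  P \in S chi -> partition P [set: 'I_n].
Hypothesis S_full : forall n (chi : n.-tuple side),
  (0 < n)%N -> [set [set: 'I_n]] \in S chi.
Variable phi : {scalar A}.

Lemma part_small n (chi : n.-tuple side) P V :
  P \in S chi -> P != [set [set: 'I_n]] -> V \in P -> (#|V| < n)%N.
Proof.
move=> SP neq PV; rewrite ltn_neqAle andbC -[X in (_ <= X)%N](card_ord n) max_card /=.
apply: contraNneq neq => cV.
have VT : V = setT by apply/eqP; rewrite eqEcard subsetT cardsT card_ord cV leqnn.
case/and3P: (S_partition SP) => _ tI n0.
apply/eqP/setP => W; rewrite inE; apply/idP/eqP => [PW|->]; last by rewrite -VT.
apply/eqP; rewrite -VT; apply: contraTT n0 => neWV.
move/trivIsetP: tI => /(_ W V PW PV neWV).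
by rewrite VT -setI_eq0 setIT negbK => /eqP <-.
Qed.

Fixpoint approx (m : nat) : functional_family := fun n chi x =>
  if m is m'.+1 then
    if n == 0%N then 0 else
    phi (\prod_(i < n) tnth x i) -
    \sum_(P in S chi | P != [set [set: 'I_n]])
      \prod_(V in P) approx m' (restr V chi) (restr V x)
  else 0.

Lemma approx_stable m n (chi : n.-tuple side) x :
  (n <= m)%N -> approx m chi x = approx n chi x.
Proof.
elim/ltn_ind: n m chi x => n IH m chi x; case: m => [|m].
  by rewrite leqn0 => /eqP n0; move: chi x; rewrite n0.
case: n IH chi x => [|n] IH chi x; first by [].
rewrite ltnS => lenm /=; congr (_ - _); apply: eq_bigr => P /andP[SP neqP].
apply: eq_bigr => V PV; have lt := part_small SP neqP PV.
by rewrite IH ?(leq_trans _ lenm) // [RHS]IH.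
Qed.

Lemma tnth_set_entry n (x : n.-tuple A) i u j :
  tnth (set_entry x i u) j = if j == i then u else tnth x j.
Proof. by rewrite tnth_mktuple. Qed.

Lemma restr_set_entry n (x : n.-tuple A) (V : {set 'I_n}) i u (iV : i \in V) :
  restr V (set_entry x i u) = set_entry (restr V x) (enum_rank_in iV i) u.
Proof.
apply: eq_from_tnth => j; rewrite !tnth_mktuple.
by rewrite -(inj_eq enum_val_inj) (enum_rankK_in iV iV).
Qed.

Lemma restr_set_entryN n (x : n.-tuple A) (V : {set 'I_n}) i u :
  i \notin V -> restr V (set_entry x i u) = restr V x.
Proof.
move=> iV; apply: eq_from_tnth => j; rewrite !tnth_mktuple.
by case: eqP => // ij; move: iV; rewrite -ij enum_valP.
Qed.

Lemma prod_linear n (x : n.-tuple A) i :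
  exists a b : A, forall u, \prod_(j < n) tnth (set_entry x i u) j = a * u * b.
Proof.
have : uniq (index_enum 'I_n) := index_enum_uniq _.
have : i \in index_enum 'I_n := mem_index_enum _.
case/splitPr => r1 r2; rewrite cat_uniq /= => /and3P[_ + /andP[ir2 _]].
rewrite negb_or => /andP[ir1 _].
exists (\prod_(j <- r1) tnth x j), (\prod_(j <- r2) tnth x j) => u.
have E r : i \notin r ->
    \prod_(j <- r) tnth (set_entry x i u) j = \prod_(j <- r) tnth x j.
  move=> ir; apply: eq_big_seq => j jr; rewrite tnth_set_entry.
  by case: eqP => // ji; move: ir; rewrite -ji jr.
by rewrite big_cat big_cons /= !E // tnth_set_entry eqxx mulrA.
Qed.

Lemma approx_multilinear m n (chi : n.-tuple side) : multilinear (approx m chi).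
Proof.
elim: m n chi => [|m IH] n chi x i a u v /=; first by rewrite mulr0 addr0.
have n_gt0 : (0 < n)%N by apply: leq_ltn_trans (ltn_ord i).
rewrite !gtn_eqF //.
have [p [q E]] := prod_linear x i; rewrite !E.
rewrite mulrDr mulrDl -scalerAr -scalerAl linearP /=.
rewrite mulrBr addrACA -opprD; congr (_ - _).
rewrite mulr_sumr -big_split /=; apply: eq_bigr => P /andP[SP neqP].
case/and3P: (S_partition SP) => /eqP covP tI n0.
have : i \in cover P by rewrite covP inE.
case/bigcupP => V PV iV.
have Eo w : \prod_(W in P | W != V) approx m (restr W chi) (restr W (set_entry x i w))
   = \prod_(W in P | W != V) approx m (restr W chi) (restr W x).
  apply: eq_bigr => W /andP[PW neWV]; rewrite restr_set_entryN //.
  move/trivIsetP: tI => /(_ W V PW PV neWV); rewrite disjoint_sym.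
  by move=> /disjointFr ->.
rewrite !(bigD1 V PV) /= !Eo !(restr_set_entry _ _ iV) IH.
by rewrite mulrDl mulrA.
Qed.

Lemma cumulants_exist : exists kappa, is_cumulants S phi kappa.
Proof.
exists (fun n => approx n (n := n)); split=> [//|n chi|n chi x n_gt0].
  exact: approx_multilinear.
rewrite (bigD1 [set [set: 'I_n]]) ?S_full //= big_set1.
rewrite (restr_full (fun n => approx n (n := n))).
case: n n_gt0 chi x => // n _ chi x /=.
apply/esym/eqP; rewrite -[X in _ == X](subrK (\sum_(P in S chi | P != [set setT]) \prod_(V in P) approx n (restr V chi) (restr V x))).
rewrite (inj_eq (addrI _)); apply/eqP; apply: eq_bigr => P /andP[SP neqP].
apply: eq_bigr => V PV; have lt := part_small SP neqP PV.
by rewrite approx_stable.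
Qed.

Lemma cumulants_unique kappa kappa' :
  is_cumulants S phi kappa -> is_cumulants S phi kappa' -> kappa = kappa'.
Proof.
move=> [k0 _ kE] [k0' _ kE'].
apply: functional_extensionality_dep => n.
apply: functional_extensionality_dep => chi.
apply: functional_extensionality_dep => x.
elim/ltn_ind: n chi x => n IH chi x; case: (posnP n) => [n0|n_gt0].
  by move: chi x; rewrite n0 => chi x; rewrite k0 k0'.
have := kE _ chi x n_gt0; rewrite (kE' _ chi x n_gt0).
rewrite (bigD1 [set [set: 'I_n]]) ?S_full //= big_set1 restr_full.
rewrite [RHS](bigD1 [set [set: 'I_n]]) ?S_full //= big_set1 restr_full.
suff -> : \sum_(P in S chi | P != [set setT])
      \prod_(V in P) kappa #|V| (restr V chi) (restr V x) =
    \sum_(P in S chi | P != [set setT])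
      \prod_(V in P) kappa' #|V| (restr V chi) (restr V x).
  by move/addIr.
apply: eq_bigr => P /andP[SP neqP]; apply: eq_bigr => V PV.
exact: IH (part_small SP neqP PV) _ _.
Qed.

End Existence.

Lemma BNC_partition n (chi : n.-tuple side) P :
  P \in BNC chi -> partition P [set: 'I_n].
Proof. by rewrite inE => /andP[]. Qed.

Lemma BI_partition n (chi : n.-tuple side) P :
  P \in BI chi -> partition P [set: 'I_n].
Proof. by rewrite inE => /andP[]. Qed.

Lemma partition_full n :
  (0 < n)%N -> partition [set [set: 'I_n]] [set: 'I_n].
Proof.
move=> n_gt0; apply/and3P; split; first by rewrite /cover big_set1.
  by apply/trivIsetP => V W /set1P-> /set1P->; rewrite eqxx.
by rewrite inE eq_sym -card_gt0 cardsT card_ord.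
Qed.

Lemma BNC_full n (chi : n.-tuple side) :
  (0 < n)%N -> [set [set: 'I_n]] \in BNC chi.
Proof.
move=> n_gt0; rewrite inE partition_full //=.
apply/forall_inP => V /set1P->; apply/forall_inP => W /set1P->.
by rewrite eqxx.
Qed.

Lemma BI_full n (chi : n.-tuple side) :
  (0 < n)%N -> [set [set: 'I_n]] \in BI chi.
Proof.
move=> n_gt0; rewrite inE partition_full //=.
apply/forall_inP => V /set1P->; apply/forall_inP => a _.
apply/forall_inP => c _; apply/forallP => b.
by rewrite inE implybT.
Qed.

Definition lr_cumulants (phi : {scalar A}) : functional_family :=
  proj1_sig (constructive_indefinite_description _
    (cumulants_exist BNC_partition BNC_full phi)).

Definition B_lr_cumulants (phi : {scalar A}) : functional_family :=
  proj1_sig (constructive_indefinite_description _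
    (cumulants_exist BI_partition BI_full phi)).

Lemma lr_cumulantsP (phi : {scalar A}) :
  is_cumulants BNC phi (lr_cumulants phi).
Proof. exact: proj2_sig (constructive_indefinite_description _ _). Qed.

Lemma B_lr_cumulantsP (phi : {scalar A}) :
  is_cumulants BI phi (B_lr_cumulants phi).
Proof. exact: proj2_sig (constructive_indefinite_description _ _). Qed.

Lemma lr_cumulants_unique (phi : {scalar A}) kappa :
  is_cumulants BNC phi kappa -> kappa = lr_cumulants phi.
Proof.
move=> kP; apply: cumulants_unique BNC_partition BNC_full _ _ _ kP _.
exact: lr_cumulantsP.
Qed.

Lemma B_lr_cumulants_unique (phi : {scalar A}) kappa :
  is_cumulants BI phi kappa -> kappa = B_lr_cumulants phi.
Proof.
move=> kP; apply: cumulants_unique BI_partition BI_full _ _ _ kP _.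
exact: B_lr_cumulantsP.
Qed.

End Cumulants.

(* C<Z_k : k in K>: the algebra on the free monoid of words over K, in
   which << fmu k >> is the indeterminate Z_k. *)
Definition free_alg (C : comNzRingType) (K : choiceType) : Type :=
  {malg C[{fmonom K}]}.

Section FreeAlgebra.

Variables (C : comNzRingType) (K : choiceType).

HB.instance Definition _ := GRing.Lalgebra.copy (free_alg C K) {malg C[{fmonom K}]}.

Fact free_alg_scaleAr (c : C) (p q : free_alg C K) : c *: (p * q) = p * (c *: q).
Proof.
apply/malgP => k; rewrite mcoeffZ !(@mcoeffMlw _ _ (msupp p) (msupp q)) //.
  rewrite mulr_sumr; apply: eq_bigr => k1 _; rewrite mulr_sumr.
  by apply: eq_bigr => k2 _; rewrite mcoeffZ mulrCA mulrnAr.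
exact: msuppZ_le.
Qed.

HB.instance Definition _ :=
  GRing.Lalgebra_isAlgebra.Build C (free_alg C K) free_alg_scaleAr.

Definition Z (k : K) : free_alg C K := << fmu k >>.

Record distribution := Distribution {
  dist_fun :> {scalar free_alg C K};
  dist_unital : dist_fun 1 = 1
}.

End FreeAlgebra.

Section Series.

Variables (C : comNzRingType) (K : choiceType).

(* A formal power series without constant term in the non-commuting
   indeterminates z_k, k : K, given by its coefficients on the words over K. *)
Record series0 := Series0 {
  coef : seq K -> C;
  coef_nil : coef [::] = 0
}.

Definition Cf (f : series0) (n : nat) (alpha : n.-tuple K) : C := coef f alpha.

Definition Cf_part (f : series0) (n : nat) (alpha : n.-tuple K)
    (P : {set {set 'I_n}}) : C :=
  \prod_(V in P) Cf f (restr V alpha).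

Definition coef_of (c : forall n, n.-tuple K -> C) (w : seq K) : C :=
  if w is [::] then 0 else c (size w) (in_tuple w).

(* The series with Cf_alpha = c n alpha for all n >= 1. *)
Definition series_of (c : forall n, n.-tuple K -> C) : series0 :=
  @Series0 (coef_of c) erefl.

Lemma Cf_series_of (c : forall n, n.-tuple K -> C) n (alpha : n.-tuple K) :
  (0 < n)%N -> Cf (series_of c) alpha = c n alpha.
Proof.
move=> n_gt0; rewrite /Cf /= /coef_of.
have -> : c n alpha = c (size alpha) (in_tuple alpha).
  move: (size alpha) (size_tuple alpha) (in_tuple alpha) (erefl : in_tuple alpha = alpha :> seq K).
  by move=> m eqm; case: n / eqm alpha n_gt0 => alpha _ t et; congr c; apply/esym/val_inj.
by case: alpha => -[|k s] sn //=; rewrite -(eqP sn) in n_gt0.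
Qed.

Lemma series0_ext (f g : series0) :
  (forall n (alpha : n.-tuple K), (0 < n)%N -> Cf f alpha = Cf g alpha) -> f = g.
Proof.
case: f g => [f f0] [g g0] fg.
have E : f = g.
  apply: functional_extensionality => -[|k s]; first by rewrite f0 g0.
  exact: (fg _ (in_tuple (k :: s)) isT).
by case: g / E g0 {fg} => g0; congr Series0; apply: eq_irrelevance.
Qed.

End Series.

Section Transforms.

Variables (C : comNzRingType) (I J : choiceType).
Local Notation K := (I + J)%type.

Definition side_of (k : K) : side :=
  match k with inl _ => lft | inr _ => rgt end.

Definition chi_of (n : nat) (alpha : n.-tuple K) : n.-tuple side :=
  map_tuple side_of alpha.

Definition star (f g : series0 C K) : series0 C K :=
  series_of (fun n (alpha : n.-tuple K) =>
    \sum_(P in BNC (chi_of alpha))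
      Cf_part f alpha P * Cf_part g alpha (K_BNC (chi_of alpha) P)).

Definition R_series (mu : distribution C K) : series0 C K :=
  series_of (fun n (alpha : n.-tuple K) =>
    lr_cumulants mu (chi_of alpha) (map_tuple (@Z C K) alpha)).

Definition eta_series (mu : distribution C K) : series0 C K :=
  series_of (fun n (alpha : n.-tuple K) =>
    B_lr_cumulants mu (chi_of alpha) (map_tuple (@Z C K) alpha)).

Section MomentSeries.

Variable S : forall n, n.-tuple side -> {set {set {set 'I_n}}}.
Variable f : series0 C K.

Definition moment (w : seq K) : C :=
  if w is [::] then 1 else
  \sum_(P in S (chi_of (in_tuple w))) Cf_part f (in_tuple w) P.

Definition moment_functional (p : free_alg C K) : C :=
  \sum_(w <- msupp p) p@_w * moment w.

Lemma moment_functionalEw (d : {fset {fmonom K}}) p : fsubset (msupp p) d ->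
  moment_functional p = \sum_(w <- d) p@_w * moment w.
Proof.
move=> le; rewrite /moment_functional; apply: big_fset_incl => // x xd /mcoeff_outdom ->.
by rewrite mul0r.
Qed.

Fact moment_functional_scalar : scalar moment_functional.
Proof.
move=> c p q.
pose d := fsetU (msupp p) (msupp q).
rewrite (@moment_functionalEw d p) ?fsubsetUl //.
rewrite (@moment_functionalEw d q) ?fsubsetUr //.
rewrite (@moment_functionalEw d).
  rewrite mulr_sumr -big_split /=; apply: eq_bigr => w _.
  by rewrite mcoeffD mcoeffZ mulrDl mulrA.
apply: (fsubset_trans (msuppD_le _ _)); apply: fsetSU; exact: msuppZ_le.
Qed.

HB.instance Definition _ :=
  GRing.isLinear.Build C (free_alg C K) C _
    moment_functional moment_functional_scalar.

Lemma moment_functionalU (w : seq K) : moment_functional << FMonom w >> = moment w.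
Proof.
rewrite (@moment_functionalEw (fset1 (FMonom w))) ?msuppU_le //.
by rewrite big_seq_fset1 mcoeffUU mul1r.
Qed.

Lemma moment_functional1 : moment_functional 1 = 1.
Proof.
have -> : 1 = << FMonom [::] >> :> free_alg C K.
  by congr mkmalgU; rewrite -fmoneE.
by rewrite moment_functionalU.
Qed.

Definition moment_dist : distribution C K := @Distribution C K moment_functional moment_functional1.

Lemma prod_Z (s : seq K) : \prod_(k <- s) Z C k = << FMonom s >>.
Proof.
elim: s => [|k s IH]; first by rewrite big_nil; congr mkmalgU; rewrite -fmoneE.
rewrite big_cons IH /Z; apply: etrans (fgmulUU _ _ _ _) _.
by rewrite mulr1; congr mkmalgU; apply: val_inj; rewrite /= fmM fmU.
Qed.

Hypothesis S_partition : forall n (chi : n.-tuple side) P,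
  P \in S chi -> partition P [set: 'I_n].
Hypothesis S_full : forall n (chi : n.-tuple side),
  (0 < n)%N -> [set [set: 'I_n]] \in S chi.

Lemma restr_map (T U : Type) (h : T -> U) n (V : {set 'I_n}) (x : n.-tuple T) :
  restr V (map_tuple h x) = map_tuple h (restr V x).
Proof. by apply: eq_from_tnth => i; rewrite !(tnth_mktuple, tnth_map). Qed.

Lemma moment_tuple n (alpha : n.-tuple K) : (0 < n)%N ->
  moment alpha = \sum_(P in S (chi_of alpha)) Cf_part f alpha P.
Proof.
move=> n_gt0; have := Cf_series_of (fun n (alpha : n.-tuple K) => \sum_(P in S (chi_of alpha)) Cf_part f alpha P) alpha n_gt0.
rewrite /Cf /= /coef_of /moment => <-.
by case: (tval alpha) (size_tuple alpha) => //= n0; rewrite -n0 in n_gt0.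
Qed.

Lemma cumulants_moment_dist kappa n (alpha : n.-tuple K) :
  is_cumulants S moment_functional kappa -> (0 < n)%N ->
  kappa n (chi_of alpha) (map_tuple (@Z C K) alpha) = Cf f alpha.
Proof.
move=> [_ _ kE]; elim/ltn_ind: n alpha => n IH alpha n_gt0.
have := kE n (chi_of alpha) (map_tuple (@Z C K) alpha) n_gt0.
rewrite -(big_tuple _ _ _ xpredT id) big_map prod_Z /= moment_functionalU moment_tuple //.
rewrite (bigD1 [set [set: 'I_n]]) ?S_full //= [RHS](bigD1 [set [set: 'I_n]]) ?S_full //= /Cf_part !big_set1.
rewrite restr_full (restr_full (fun n (_ : n.-tuple side) (x : n.-tuple K) => Cf f x) (chi_of alpha)).
suff E : \sum_(P in S (chi_of alpha) | P != [set setT])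
      \prod_(V in P) kappa #|V| (restr V (chi_of alpha))
         (restr V (map_tuple (@Z C K) alpha)) =
    \sum_(P in S (chi_of alpha) | P != [set setT])
      \prod_(V in P) Cf f (restr V alpha).
  by rewrite E => /addIr/esym.
apply: eq_bigr => P /andP[SP neqP]; apply: eq_bigr => V PV.
rewrite !restr_map IH ?(part_small S_partition SP neqP PV) //.
case/and3P: (S_partition SP) => _ _; apply: contraR.
by rewrite -eqn0Ngt cards_eq0 => /eqP <-.
Qed.

End MomentSeries.

Lemma R_series_surj (f : series0 C K) : exists mu, R_series mu = f.
Proof.
exists (moment_dist BNC f); apply: series0_ext => n alpha n_gt0.
rewrite Cf_series_of // (@cumulants_moment_dist BNC f) //.
- exact: BNC_partition.
- exact: BNC_full.
exact: lr_cumulantsP.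
Qed.

Lemma dist_moment (mu : distribution C K) (w : seq K) :
  mu << FMonom w >> = moment BNC (R_series mu) w.
Proof.
rewrite -prod_Z; case: w => [|k w]; first by rewrite big_nil dist_unital.
set t := in_tuple (k :: w).
have -> : \prod_(k <- k :: w) Z C k =
    \prod_(i < size (k :: w)) tnth (map_tuple (@Z C K) t) i.
  by rewrite -(big_tuple _ _ _ xpredT id) big_map.
have [_ _ /(_ _ (chi_of t) (map_tuple (@Z C K) t) isT) ->] := lr_cumulantsP mu.
apply: eq_bigr => P SP; apply: eq_bigr => V PV.
rewrite Cf_series_of ?restr_map //.
case/and3P: (BNC_partition SP) => _ _; apply: contraR.
by rewrite -eqn0Ngt cards_eq0 => /eqP <-.
Qed.

Lemma R_series_inj : injective R_series.
Proof.
move=> mu nu eqR.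
have muE (lam : distribution C K) p :
    lam p = \sum_(w <- msupp p) p@_w * moment BNC (R_series lam) w.
  rewrite {1}[p]monalgE linear_sum; apply: eq_bigr => w _.
  rewrite -dist_moment fmK -linearZ; congr (dist_fun _ _); apply/malgP => v.
  by rewrite mcoeffZ !mcoeffU mulr_natr.
have {muE eqR} E : mu =1 nu by move=> p; rewrite !muE eqR.
case: mu nu E => [[m cm] m1] [[n' cn] n1] /= /functional_extensionality E.
case: n' / E cn n1 => -[[a] [b]] n1; case: cm m1 => -[a'] [b'] m1.
rewrite (proof_irrelevance _ a a') (proof_irrelevance _ b b') in n1 *.
by congr Distribution; apply: proof_irrelevance.
Qed.

Definition R_inv (f : series0 C K) : distribution C K :=
  proj1_sig (constructive_indefinite_description _ (R_series_surj f)).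

Definition bReta (f : series0 C K) : series0 C K := eta_series (R_inv f).

End Transforms.

(* Main.v *)
Require Import Defs.
From HB Require Import structures.
From mathcomp Require Import all_boot all_fingroup all_algebra.
From mathcomp Require Import reals complex boolp zify.

(* List the positions of a fixed word in the order of s_chi: everything becomes
   a statement on ordinary non-crossing partitions, and on formal series in
   noncommuting letters, one letter per position.

   Write a = cst + sum_x a^x z_x and b = cst + sum_x z_x b_x, and let h be the
   product of a and b.  Cutting a non-crossing partition and its Kreweras
   complement along their outer blocks gives h = a(T) = b(U), up to constant
   terms, where U_x = a^x(T) z_x and T_x = z_x b_x(U).  Taking all coefficients
   of b equal to 1 gives the moment series: M_a = 1 + a(z M_a), up to the constant
   term of a, and since moments are also sums over interval partitions, the
   eta-series of a is eta_a = 1 - M_a^-1.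

   Let M = M_h, let rho be the substitution z_x |-> z_x M, and put
   V_x = rho(U_x) M^-1 and W_x = rho(T_x) M^-1.  By uniqueness of the solution of
   N = 1 + b(N V) one gets M = M_b(V), and likewise M = M_a(W).  Hence V and W
   solve the system that defines the product of eta_a and eta_b, which is
   therefore eta_b(V) = 1 - M_b(V)^-1 = 1 - M^-1 = eta_h. *)

Set Implicit Arguments.
Unset Strict Implicit.
Unset Printing Implicit Defensive.

Import GRing.Theory.
Local Open Scope ring_scope.

(** * Noncommutative power series *)

(** Listing a word in the order of s_chi forgets how its left and right letters interleave, yet this
    decides which coefficient of f a block reads. Positions remember it: a set of positions
    determines its subword of the original word. The price is that the series attached to f is
    meaningful only on subsequences of the listed word. The identity is still proved in the whole
    ring of series; it can be applied because the coefficient of a product or of an eta-series at a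
    subsequence involves only coefficients at subsequences.

    The choice of rho comes from the moment equation M = 1 + h(z M), up to constant terms: it says
    that rho(h) is M, so rho turns h = b(U) = a(T) into statements about M. The factors M^-1 are
    placed by the rule that conjugation by M exchanges the substitutions z M and M z; the b-side
    needs the second form, the a-side the first. *)

Definition ncs (C : comNzRingType) (T : finType) := seq T -> C.

Section Series.
Variables (C : comNzRingType) (T : finType).
Implicit Types (F G H M a b : ncs C T) (w : seq T) (x y : T).

HB.instance Definition _ := gen_eqMixin (ncs C T).
HB.instance Definition _ := gen_choiceMixin (ncs C T).

Definition ncs_add F G : ncs C T := fun w => F w + G w.
Definition ncs_opp F : ncs C T := fun w => - F w.
Definition ncs_zero : ncs C T := fun _ => 0.

Fact ncs_addA : associative ncs_add.
Proof. by move=> F G H; apply: funext => w; apply: addrA. Qed.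
Fact ncs_addC : commutative ncs_add.
Proof. by move=> F G; apply: funext => w; apply: addrC. Qed.
Fact ncs_add0 : left_id ncs_zero ncs_add.
Proof. by move=> F; apply: funext => w; apply: add0r. Qed.
Fact ncs_addN : left_inverse ncs_zero ncs_opp ncs_add.
Proof. by move=> F; apply: funext => w; apply: addNr. Qed.

HB.instance Definition _ :=
  GRing.isZmodule.Build (ncs C T) ncs_addA ncs_addC ncs_add0 ncs_addN.

(** In the notation of the header, b_x is [dl x b] and a^x is [dr x a]. *)
Definition dl x F : ncs C T := fun w => F (x :: w).
Definition dr x F : ncs C T := fun w => F (rcons w x).
Definition cst (c : C) : ncs C T := fun w => if w is [::] then c else 0.
Definition letter x : ncs C T := fun w => (w == [:: x])%:R.

(** Peeling the first letter turns the ring laws into inductions on the word; the convolution over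
    cut points is recovered in [ncsME]. *)
Fixpoint ncs_mul_rec F G w : C :=
  if w is x :: w' then F [::] * G w + ncs_mul_rec (dl x F) G w'
  else F [::] * G [::].
Definition ncs_mul F G : ncs C T := ncs_mul_rec F G.

Lemma ncsDE F G w : (F + G) w = F w + G w. Proof. by []. Qed.
Lemma ncsNE F w : (- F) w = - F w. Proof. by []. Qed.
Lemma ncs_sumE (I : Type) (r : seq I) (P : pred I) (E : I -> ncs C T) w :
  (\sum_(i <- r | P i) E i) w = \sum_(i <- r | P i) E i w.
Proof. by apply: (big_ind2 (fun F c => F w = c)) => // F c G d <- <-. Qed.

Lemma ncs_mul_cons F G x w :
  ncs_mul F G (x :: w) = F [::] * G (x :: w) + ncs_mul (dl x F) G w.
Proof. by []. Qed.

Fact ncs_mulDl : left_distributive ncs_mul +%R.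
Proof.
move=> F G H; apply: funext => w; elim: w F G => [|x w IH] F G.
  exact: mulrDl.
by rewrite ncsDE !ncs_mul_cons [LHS]/= ncsDE mulrDl IH addrACA.
Qed.

Fact ncs_mulDr : right_distributive ncs_mul +%R.
Proof.
move=> F G H; apply: funext => w; elim: w F => [|x w IH] F.
  exact: mulrDr.
by rewrite ncsDE !ncs_mul_cons [LHS]/= ncsDE mulrDr IH addrACA.
Qed.

Lemma cst_mul c F : ncs_mul (cst c) F = fun w => c * F w.
Proof.
apply: funext => -[|x w] //; rewrite ncs_mul_cons /=.
suff -> : dl x (cst c) = 0.
  rewrite [X in _ + X](_ : _ = 0) ?addr0 //.
  by elim: w => [|y w IH]; rewrite ?ncs_mul_cons /= mul0r ?add0r.
exact: funext.
Qed.

Lemma mul_cst F c : ncs_mul F (cst c) = fun w => c * F w.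
Proof.
apply: funext => w; elim: w F => [|x w IH] F; first exact: mulrC.
by rewrite ncs_mul_cons mulr0 add0r IH.
Qed.

Lemma dl_ncs_mul x F G :
  dl x (ncs_mul F G) = ncs_mul (dl x F) G + ncs_mul (cst (F [::])) (dl x G).
Proof.
by rewrite cst_mul; apply: funext => w; rewrite ncsDE addrC.
Qed.

Lemma ncs_mul_scale c F G w : ncs_mul (fun v => c * F v) G w = c * ncs_mul F G w.
Proof.
elim: w F => [|x w IH] F; first by rewrite /= mulrA.
by rewrite !ncs_mul_cons mulrDr mulrA; congr (_ + _); apply: IH.
Qed.

Fact ncs_mulA : associative ncs_mul.
Proof.
move=> F G H; apply: funext => w; elim: w F G => [|x w IH] F G.
  exact: mulrA.
rewrite [in RHS]ncs_mul_cons dl_ncs_mul ncs_mulDl cst_mul ncsDE -IH ncs_mul_scale.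
rewrite ncs_mul_cons [ncs_mul G H _]ncs_mul_cons mulrDr mulrA -addrA.
by congr (_ + _); apply: addrC.
Qed.

Fact ncs_mul1 : left_id (cst 1) ncs_mul.
Proof. by move=> F; rewrite cst_mul; apply: funext => w; rewrite mul1r. Qed.
Fact ncs_mulr1 : right_id (cst 1) ncs_mul.
Proof. by move=> F; rewrite mul_cst; apply: funext => w; rewrite mul1r. Qed.

HB.instance Definition _ := GRing.Zmodule_isPzRing.Build (ncs C T)
  ncs_mulA ncs_mul1 ncs_mulr1 ncs_mulDl ncs_mulDr.

Lemma ncsM_nil F G : (F * G) [::] = F [::] * G [::]. Proof. by []. Qed.
Lemma ncs1E : 1 = cst 1 :> ncs C T. Proof. by []. Qed.
Lemma cstM c F : cst c * F = F * cst c.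
Proof. by apply: etrans (cst_mul _ _) _; apply: esym (mul_cst _ _). Qed.
Lemma cstME c F w : (cst c * F) w = c * F w.
Proof. by have /= := congr1 (fun G => G w) (cst_mul c F). Qed.
Lemma dlM x F G : dl x (F * G) = dl x F * G + cst (F [::]) * dl x G.
Proof. exact: dl_ncs_mul. Qed.
Lemma cst0 : cst 0 = 0.
Proof. by apply: funext => -[]. Qed.
Lemma cstMc c d : cst (c * d) = cst c * cst d.
Proof. by apply: funext => -[|x w] //; rewrite cstME mulr0. Qed.
Lemma cstDc c d : cst (c + d) = cst c + cst d.
Proof. by apply: funext => -[|x w] //; rewrite ncsDE addr0. Qed.

Lemma ncsME F G w : (F * G) w =
  \sum_(i < (size w).+1) F (take i w) * G (drop i w).
Proof.
elim: w F => [|x w IH] F; first by rewrite big_ord_recl big_ord0 addr0.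
rewrite [LHS]ncs_mul_cons (_ : ncs_mul _ _ _ = (dl x F * G) w) // IH.
by rewrite [RHS]big_ord_recl.
Qed.

Lemma letter_nil x : letter x [::] = 0. Proof. by []. Qed.

Lemma letterM_cons x F y w : (letter x * F) (y :: w) = (x == y)%:R * F w.
Proof.
rewrite [LHS]ncs_mul_cons mul0r add0r.
have -> : dl y (letter x) = cst (x == y)%:R.
  apply: funext => -[|u v]; rewrite /dl /letter /= eqseq_cons eq_sym ?andbT //.
  by rewrite andbF.
exact: cstME.
Qed.

Lemma Mletter_rcons F x w y : (F * letter x) (rcons w y) = (x == y)%:R * F w.
Proof.
elim: w F => [|u w IH] F /=.
  rewrite [LHS]ncs_mul_cons (_ : ncs_mul _ _ _ = (dl y F * letter x) [::]) //.
  by rewrite ncsM_nil mulr0 addr0 /letter eqseq_cons andbT eq_sym mulrC.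
rewrite [LHS]ncs_mul_cons (_ : ncs_mul _ _ _ = (dl u F * letter x) (rcons w y)) //.
rewrite IH /letter eqseq_cons -size_eq0 size_rcons andbF mulr0 add0r.
by [].
Qed.

Lemma dr_decomp F : F = cst (F [::]) + \sum_x dr x F * letter x.
Proof.
apply: funext => w; rewrite ncsDE ncs_sumE; case/lastP: w => [|w y].
  by rewrite big1 ?addr0 // => x _; rewrite ncsM_nil mulr0.
rewrite (_ : cst _ _ = 0) ?add0r; last by case: w.
rewrite (bigD1 y) //= Mletter_rcons eqxx mul1r big1 ?addr0 // => x /negPf.
by rewrite Mletter_rcons => ->; rewrite mul0r.
Qed.

Lemma dr_unique c (E : T -> ncs C T) x :
  dr x (cst c + \sum_y E y * letter y) = E x.
Proof.
apply: funext => w; rewrite /dr ncsDE ncs_sumE (_ : cst _ _ = 0) ?add0r; last by case: w.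
rewrite (bigD1 x) //= Mletter_rcons eqxx mul1r big1 ?addr0 // => y /negPf.
by rewrite Mletter_rcons => ->; rewrite mul0r.
Qed.

Lemma dl_unique c (E : T -> ncs C T) x :
  dl x (cst c + \sum_y letter y * E y) = E x.
Proof.
apply: funext => w; rewrite /dl ncsDE ncs_sumE /= add0r.
rewrite (bigD1 x) //= letterM_cons eqxx mul1r big1 ?addr0 // => y /negPf.
by rewrite letterM_cons => ->; rewrite mul0r.
Qed.

(* Equality up to degree [n], the metric in which the operators below contract. *)
Definition agree n F G := forall w, (size w < n)%N -> F w = G w.

Lemma agree_le m n F G : (m <= n)%N -> agree n F G -> agree m F G.
Proof. by move=> le FG w lt; apply: FG; apply: leq_trans le. Qed.

Lemma agree_eq F G : (forall n, agree n F G) -> F = G.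
Proof. by move=> FG; apply: funext => w; apply: (FG (size w).+1). Qed.

Lemma agreeD n F F' G G' :
  agree n F F' -> agree n G G' -> agree n (F + G) (F' + G').
Proof. by move=> FF GG w lt; rewrite !ncsDE FF ?GG. Qed.

Lemma agree_sum n (E E' : T -> ncs C T) :
  (forall x, agree n (E x) (E' x)) -> agree n (\sum_x E x) (\sum_x E' x).
Proof. by move=> EE w lt; rewrite !ncs_sumE; apply: eq_bigr => x _; apply: EE. Qed.

Lemma agreeM n F F' G G' :
  agree n F F' -> agree n G G' -> agree n (F * G) (F' * G').
Proof.
move=> FF GG w lt; rewrite !ncsME; apply: eq_bigr => i _.
by rewrite FF ?GG ?size_drop ?(leq_ltn_trans (leq_subr _ _)) // size_take_min
  (leq_ltn_trans (geq_minr _ _)).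
Qed.

(** This is where contraction comes from: the empty prefix contributes nothing, so [G] is read on
    proper suffixes only and one degree is gained. *)
Lemma agreeM0l n F F' G G' : F [::] = 0 -> F' [::] = 0 ->
  agree n.+1 F F' -> agree n G G' -> agree n.+1 (F * G) (F' * G').
Proof.
move=> F0 F'0 FF GG w lt; rewrite !ncsME !big_ord_recl take0 F0 F'0 !mul0r.
congr (_ + _); apply: eq_bigr => i _.
rewrite FF ?size_take_min ?(leq_ltn_trans (geq_minr _ _)) // GG //.
by rewrite size_drop lift0; have := ltn_ord i; lia.
Qed.

Lemma agreeM0r n F F' G G' : G [::] = 0 -> G' [::] = 0 ->
  agree n F F' -> agree n.+1 G G' -> agree n.+1 (F * G) (F' * G').
Proof.
move=> G0 G'0 FF GG w lt; rewrite !ncsME !big_ord_recr /= drop_size G0 G'0 !mulr0.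
congr (_ + _); apply: eq_bigr => i _.
rewrite GG ?size_drop ?(leq_ltn_trans (leq_subr _ _)) // FF //.
by rewrite size_take ltn_ord (leq_trans (ltn_ord i)).
Qed.

(** * Fixed points of contracting operators on families of series *)

Section Contraction.
Variables (I : Type) (op : (I -> ncs C T) -> I -> ncs C T).
Hypothesis op_contr : forall n X Y, (forall i, agree n (X i) (Y i)) ->
  forall i, agree n.+1 (op X i) (op Y i).

(** After [size w] + 1 iterations the coefficient at [w] no longer changes, and it does not depend
    on the starting family. *)
Definition fixpt i : ncs C T := fun w => iter (size w).+1 op (fun _ => 0) i w.

Lemma agree_iter X Y n i : agree n (iter n op X i) (iter n op Y i).
Proof. by elim: n i => [|n IH] i; [case | apply: op_contr]. Qed.

Lemma fixpt_iter n i : agree n (fixpt i) (iter n op (fun _ => 0) i).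
Proof.
move=> w lt; rewrite /fixpt -(subnK lt) addnC iterD.
exact: agree_iter.
Qed.

Lemma fixptE i : fixpt i = op fixpt i.
Proof.
apply: funext => w; rewrite {1}/fixpt iterS.
by apply: (@op_contr (size w)) => // j v lt; apply/esym/fixpt_iter.
Qed.

Lemma fix_unique X Y : (forall i, X i = op X i) -> (forall i, Y i = op Y i) ->
  forall i, X i = Y i.
Proof.
move=> EX EY i; apply: agree_eq => n; elim: n i => [|n IH] i; first by case.
by rewrite EX EY; apply: op_contr.
Qed.

End Contraction.

(** * Substitution of series without constant term *)

Section Substitution.
Variable L : T -> ncs C T.
Hypothesis L0 : forall x, L x [::] = 0.

(* [subst F] is the series F(L): each letter [x] is replaced by the series [L x],
   which must have no constant term. *)
Definition subst_op (S : ncs C T -> ncs C T) F : ncs C T :=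
  cst (F [::]) + \sum_x L x * S (dl x F).

Definition subst : ncs C T -> ncs C T := fixpt subst_op.

(** The unknown is the whole map F -> F(L), a family indexed by all series, since the equation at F
    calls on the quotients [dl x F]. *)
Lemma subst_op_contr n X Y : (forall F, agree n (X F) (Y F)) ->
  forall F, agree n.+1 (subst_op X F) (subst_op Y F).
Proof.
move=> XY F; apply: agreeD => //; apply: agree_sum => x.
exact: agreeM0l.
Qed.

Lemma substE F : subst F = cst (F [::]) + \sum_x L x * subst (dl x F).
Proof. exact: fixptE subst_op_contr F. Qed.

Lemma subst_nil F : subst F [::] = F [::].
Proof.
by rewrite substE ncsDE ncs_sumE big1 ?addr0 // => x _; rewrite ncsM_nil L0 mul0r.
Qed.

Lemma subst_cst c : subst (cst c) = cst c.
Proof.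
(* All quotients of 0 are 0, so [subst 0] and 0 both solve S = sum of the L_x S, which contracts. *)
have s0 : subst 0 = 0.
  apply: (@fix_unique _ (fun (S : unit -> ncs C T) i => \sum_x L x * S i) _
    (fun _ => subst 0) (fun _ => 0) _ _ tt) => [n X Y XY [] | _ | _].
  - by apply: agree_sum => x; apply: agreeM0l.
  - by rewrite {1}substE cst0 add0r.
  by rewrite big1 // => x _; rewrite mulr0.
rewrite substE big1 ?addr0 // => x _.
by rewrite [dl x _](_ : _ = 0) ?s0 ?mulr0.
Qed.

Lemma subst0 : subst 0 = 0. Proof. by rewrite -cst0 subst_cst. Qed.
Lemma subst1 : subst 1 = 1. Proof. exact: subst_cst. Qed.

Lemma substD F G : subst (F + G) = subst F + subst G.
Proof.
apply: agree_eq => n; elim: n F G => [|n IH] F G; first by case.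
rewrite [subst (F + G)]substE [subst F]substE [subst G]substE ncsDE cstDc addrACA.
rewrite -big_split /=; apply: agreeD => //; apply: agree_sum => x.
rewrite -mulrDr; apply: agreeM0l => //; exact: IH.
Qed.

Lemma substM F G : subst (F * G) = subst F * subst G.
Proof.
apply: agree_eq => n; elim: n F G => [|n IH] F G; first by case.
rewrite [subst (F * G)]substE [subst F]substE ncsM_nil cstMc mulrDl.
rewrite [in cst _ * subst G]substE mulrDr -addrA; apply: agreeD => //.
rewrite mulr_suml mulr_sumr -big_split /=; apply: agree_sum => x.
rewrite dlM substD mulrDr addrC; apply: agreeD.
  by rewrite -mulrA; apply: agreeM0l => //; apply: IH.
(* The constant is central, and it is its own substitution, so the induction hypothesis applies to
   this term too. *)
rewrite mulrA [cst _ * L x]cstM -mulrA; apply: agreeM0l => //.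
by rewrite -[X in X * subst (dl x G)]subst_cst; apply: IH.
Qed.

Lemma subst_sum (E : T -> ncs C T) : subst (\sum_x E x) = \sum_x subst (E x).
Proof.
exact: (big_morph subst substD subst0).
Qed.

Lemma substN F : subst (- F) = - subst F.
Proof.
by apply/eqP; rewrite -addr_eq0 -substD addNr subst0.
Qed.

Lemma subst_letter x : subst (letter x) = L x.
Proof.
rewrite substE (bigD1 x) //= big1.
  rewrite addr0 (_ : dl x (letter x) = 1) ?subst1 ?mulr1.
    by rewrite (_ : cst _ = 0) ?add0r //; apply: funext => -[].
  by apply: funext => -[|y w]; rewrite /dl /letter eqseq_cons eqxx.
move=> y /negPf yx; rewrite (_ : dl y (letter x) = 0) ?subst0 ?mulr0 //.
by apply: funext => w; rewrite /dl /letter eqseq_cons yx.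
Qed.

End Substitution.

Implicit Types L : T -> ncs C T.

Lemma subst_family_unique (I : Type) L (c : I -> C) (d : I -> T -> I)
    (X Y : I -> ncs C T) : (forall x, L x [::] = 0) ->
  (forall i, X i = cst (c i) + \sum_x L x * X (d i x)) ->
  (forall i, Y i = cst (c i) + \sum_x L x * Y (d i x)) -> forall i, X i = Y i.
Proof.
move=> L0 EX EY.
apply: (@fix_unique _ (fun Z i => cst (c i) + \sum_x L x * Z (d i x))) => //.
move=> n Z Z' ZZ i; apply: agreeD => //; apply: agree_sum => x.
exact: agreeM0l.
Qed.

(** Composites and conjugates of substitutions are recognised as substitutions by checking this
    recursion on the first letter alone. *)
Lemma subst_unique L (S : ncs C T -> ncs C T) : (forall x, L x [::] = 0) ->
  (forall F, S F = cst (F [::]) + \sum_x L x * S (dl x F)) -> S =1 subst L.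
Proof.
move=> L0 SE; apply: (subst_family_unique L0 SE) => F; exact: substE.
Qed.

Lemma agree_subst n L L' F :
  (forall x, L x [::] = 0) -> (forall x, L' x [::] = 0) ->
  (forall x, agree n (L x) (L' x)) -> agree n (subst L F) (subst L' F).
Proof.
move=> L0 L'0; elim: n F => [|n IH] F LL; first by case.
rewrite (substE L0) (substE L'0); apply: agreeD => //; apply: agree_sum => x.
apply: agreeM0l => //; apply: IH => y; exact: agree_le (leqnSn n) (LL y).
Qed.

Lemma subst_comp L L' F : (forall x, L x [::] = 0) -> (forall x, L' x [::] = 0) ->
  subst L (subst L' F) = subst (fun x => subst L (L' x)) F.
Proof.
move=> L0 L'0; apply: (@subst_unique _ (fun F => subst L (subst L' F))) => [x|G].
  by rewrite subst_nil.
rewrite [subst L' G]substE // substD // subst_cst // subst_sum //.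
by congr (_ + _); apply: eq_bigr => x _; rewrite substM.
Qed.

Lemma eq_subst L L' F : (forall x, L x = L' x) -> subst L F = subst L' F.
Proof. by move=> /funext ->. Qed.

(** On a word, M (z_1 M) ... (z_k M) l regroups as (M z_1) ... (M z_k) M l, and the last two factors
    cancel. *)
Lemma subst_conj M l F : M * l = 1 ->
  M * subst (fun x => letter x * M) F * l = subst (fun x => M * letter x) F.
Proof.
move=> Ml.
apply: (@subst_unique _ (fun F => M * subst (fun x => letter x * M) F * l)) => [x|G].
  by rewrite ncsM_nil letter_nil mulr0.
rewrite [in LHS]substE ?mulrDr ?mulrDl => [|x]; last by rewrite ncsM_nil mul0r.
congr (_ + _); first by rewrite -cstM -mulrA Ml mulr1.
rewrite mulr_sumr mulr_suml; apply: eq_bigr => x _.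
by rewrite !mulrA.
Qed.

(** [X] satisfies X = (1 - F) X, an equation that contracts because 1 - F has no constant term. *)
Lemma ncs_lreg F X : F [::] = 1 -> F * X = 0 -> X = 0.
Proof.
move=> F1 FX.
apply: (@fix_unique _ (fun X (_ : unit) => (1 - F) * X tt) _ (fun _ => X)
  (fun _ => 0) _ _ tt) => [n Y Z YZ _|_|_].
- by apply: agreeM0l => //; rewrite ncsDE ncsNE F1 subrr.
- by rewrite mulrBl mul1r FX subr0.
by rewrite mulr0.
Qed.

Lemma inv_comm F G : F [::] = 1 -> F * G = 1 -> G * F = 1.
Proof.
move=> F1 FG; apply/eqP; rewrite -subr_eq0; apply/eqP; apply: (ncs_lreg F1).
by rewrite mulrBr mulrA FG mul1r mulr1 subrr.
Qed.

(** * The formal product of two series *)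

Section Star.
Variables a b : ncs C T.

(* In the notation of the header, [star_U x] is U_x = u_x z_x and [star_T x] is T_x;
   the fixed point is taken over the u_x. *)
Definition star_op (u : T -> ncs C T) x : ncs C T :=
  subst (fun y => letter y * subst (fun z => u z * letter z) (dl y b)) (dr x a).

(** The degree is gained from the letter that heads each series substituted into [dr x a]. *)
Lemma star_op_contr n X Y : (forall x, agree n (X x) (Y x)) ->
  forall x, agree n.+1 (star_op X x) (star_op Y x).
Proof.
move=> XY x; apply: agree_subst => y; rewrite ?ncsM_nil ?mul0r //.
apply: agreeM0l => //; apply: agree_subst => z; rewrite ?ncsM_nil ?mulr0 //.
exact: agreeM.
Qed.

Definition star_u : T -> ncs C T := fixpt star_op.
Definition star_U x := star_u x * letter x.
Definition star_T x := letter x * subst star_U (dl x b).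
Definition nc_star := subst star_U b.

Lemma star_U0 x : star_U x [::] = 0.
Proof. by rewrite /star_U ncsM_nil mulr0. Qed.

Lemma star_T0 x : star_T x [::] = 0.
Proof. by rewrite /star_T ncsM_nil mul0r. Qed.

Lemma star_uE x : star_u x = subst star_T (dr x a).
Proof. exact: fixptE star_op_contr x. Qed.

Lemma star_u_unique u : (forall x, u x = star_op u x) -> forall x, u x = star_u x.
Proof.
move=> uE; apply: (fix_unique star_op_contr uE) => x; exact: star_uE.
Qed.

Lemma nc_star_nil : nc_star [::] = b [::].
Proof. exact: subst_nil star_U0 b. Qed.

(** Both sides contain the sum of a^x(T) z_x b_x(U), bracketed once as U_x b_x(U) and once as a^x(T)
    T_x. *)
Lemma nc_starE : nc_star = cst (b [::] - a [::]) + subst star_T a.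
Proof.
rewrite /nc_star [LHS](substE star_U0) [in subst star_T a](dr_decomp a).
rewrite (substD star_T0) (subst_cst star_T0) addrA -cstDc subrK.
congr (_ + _); rewrite (subst_sum star_T0); apply: eq_bigr => x _.
by rewrite (substM star_T0) (subst_letter star_T0) -star_uE mulrA.
Qed.

End Star.

(** * Moment series and eta-series *)

Definition ones : ncs C T := fun _ => 1.
Definition nc_moment a := nc_star a ones.
Definition nc_eta a := \sum_x star_U a ones x.

Lemma nc_moment_nil a : nc_moment a [::] = 1.
Proof. exact: nc_star_nil. Qed.

Lemma nc_eta_nil a : nc_eta a [::] = 0.
Proof. by rewrite /nc_eta ncs_sumE big1 // => x _; apply: star_U0. Qed.

(** Every quotient of [ones] by a letter is [ones], so what follows the first factor U_x is again
    the moment series. *)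
Lemma nc_momentE a : nc_moment a = 1 + nc_eta a * nc_moment a.
Proof.
rewrite {1}/nc_moment /nc_star (substE (@star_U0 _ _)) mulr_suml.
by congr (_ + _).
Qed.

Lemma nc_momentV a : (1 - nc_eta a) * nc_moment a = 1.
Proof. by rewrite mulrBl mul1r {1}nc_momentE addrK. Qed.

Lemma nc_momentVr a : nc_moment a * (1 - nc_eta a) = 1.
Proof.
apply: inv_comm (nc_momentV a).
by rewrite ncsDE ncsNE nc_eta_nil subr0.
Qed.

Lemma rletter0 M x : (letter x * M) [::] = 0.
Proof. by rewrite ncsM_nil mul0r. Qed.

Lemma lletter0 M x : (M * letter x) [::] = 0.
Proof. by rewrite ncsM_nil mulr0. Qed.

(** When [b] is [ones], T_x is z_x M by conversion. *)
Lemma nc_moment_subst a :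
  nc_moment a = cst (1 - a [::]) + subst (fun x => letter x * nc_moment a) a.
Proof. exact: (nc_starE a ones). Qed.

(** a(z M) is M minus a constant and so commutes with M; conjugating it by M leaves it unchanged and
    turns z M into M z. *)
Lemma nc_moment_lsubst a :
  nc_moment a = cst (1 - a [::]) + subst (fun x => nc_moment a * letter x) a.
Proof.
have := nc_moment_subst a; move/eqP; rewrite addrC -subr_eq => /eqP E.
rewrite -(subst_conj a (nc_momentVr a)) -E -mulrA mulrBl cstM nc_momentVr.
by rewrite mulrBr mulr1 mulrA nc_momentVr mul1r addrC subrK.
Qed.

Lemma star_u_ones a x :
  star_u a ones x = subst (fun y => letter y * nc_moment a) (dr x a).
Proof. exact: star_uE. Qed.

Lemma dr_eta a x :
  dr x (nc_eta a) = subst (fun y => letter y * nc_moment a) (dr x a).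
Proof.
rewrite -star_u_ones -(dr_unique 0 (star_u a ones)); congr dr.
by rewrite cst0 add0r.
Qed.

(** Multiply M = 1 + sum of z_x M a_x(z M) on the right by M^-1, where a_x is [dl x a]: the left
    side becomes 1, and conjugation turns each M a_x(z M) M^-1 into a_x(M z). *)
Lemma dl_eta a x :
  dl x (nc_eta a) = subst (fun y => nc_moment a * letter y) (dl x a).
Proof.
rewrite -(dl_unique 0 (fun x => subst (fun y => nc_moment a * letter y) (dl x a)) x).
congr dl; rewrite cst0 add0r.
have := nc_moment_subst a; set M := nc_moment a.
rewrite (substE (rletter0 M)) addrA -cstDc subrK.
move=> /(congr1 (fun F => F * (1 - nc_eta a))).
rewrite nc_momentVr mulrDl -ncs1E mul1r => E.
rewrite -[LHS](subKr 1) {1}E addrAC subrr add0r.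
rewrite mulr_suml; apply: eq_bigr => y _.
by rewrite -(subst_conj _ (nc_momentVr a)) !mulrA.
Qed.

Lemma nc_eta_star a b : nc_eta (nc_star a b) = nc_star (nc_eta a) (nc_eta b).
Proof.
set h := nc_star a b; set M := nc_moment h; set l := 1 - nc_eta h.
have h0 : h [::] = b [::] := nc_star_nil a b.
have Ml : M * l = 1 := nc_momentVr h.
have lM : l * M = 1 := nc_momentV h.
pose rho := subst (fun x => letter x * M).
have r0 := rletter0 M.
(* This is rho(U_x) M^-1 after cancellation, since rho(U_x) = rho(u_x) z_x M. *)
pose V x := rho (star_u a b x) * letter x.
(* This is rho(T_x) M^-1: in z_x M rho(b_x(U)) M^-1 the conjugation by M replaces z M by M z, which
   sends U_y to M V_y. *)
pose W x := letter x * subst (fun y => M * V y) (dl x b).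
have V0 x : V x [::] = 0 by exact: lletter0.
have W0 x : W x [::] = 0 by exact: rletter0.
have MV0 x : (M * V x) [::] = 0 by rewrite ncsM_nil V0 mulr0.
have WM0 x : (W x * M) [::] = 0 by rewrite ncsM_nil W0 mul0r.
have rhoU x : rho (star_U a b x) = V x * M.
  by rewrite /rho substM // subst_letter // mulrA.
have lamU F : subst (fun x => M * letter x) (subst (star_U a b) F) =
    subst (fun x => M * V x) F.
  rewrite subst_comp; [|exact: lletter0|exact: star_U0].
  by apply: eq_subst => x; rewrite -(subst_conj _ Ml) -/rho rhoU -!mulrA Ml mulr1.
have rhoT x : rho (star_T a b x) = W x * M.
  rewrite /rho substM // subst_letter // /W -lamU -(subst_conj _ Ml).
  by rewrite -!mulrA lM mulr1.
have VE x : V x = subst (fun y => W y * M) (dr x a) * letter x.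
  rewrite /V star_uE /rho subst_comp //; last exact: star_T0.
  by congr (_ * _); apply: eq_subst => y; rewrite -rhoT.
(* Since h has the constant term of [b], the left moment equation of h = b(U), read through [lamU],
   is exactly the equation that M_b(V) satisfies. *)
have MbV : M = subst V (nc_moment b).
  apply: (@fix_unique _ (fun N (_ : unit) =>
      cst (1 - b [::]) + subst (fun x => N tt * V x) b) _
      (fun _ => M) (fun _ => subst V (nc_moment b)) _ _ tt) => [n X Y XY _|_|_].
  - apply: agreeD => //; apply: agree_subst => x; rewrite ?ncsM_nil ?V0 ?mulr0 //.
    exact: agreeM0r.
  - rewrite {1}/M nc_moment_lsubst -/M h0; congr (_ + _); exact: lamU.
  rewrite {1}nc_moment_lsubst substD // subst_cst // subst_comp //; last exact: lletter0.
  congr (_ + _); apply: eq_subst => x.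
  by rewrite substM // subst_letter.
(* Mirror image, from the right moment equation and h = a(T). Here h has the constant term of [b],
   not of [a]; the shift in [nc_starE] compensates. *)
have MaW : M = subst W (nc_moment a).
  apply: (@fix_unique _ (fun N (_ : unit) =>
      cst (1 - a [::]) + subst (fun x => W x * N tt) a) _
      (fun _ => M) (fun _ => subst W (nc_moment a)) _ _ tt) => [n X Y XY _|_|_].
  - apply: agreeD => //; apply: agree_subst => x; rewrite ?ncsM_nil ?W0 ?mul0r //.
    exact: agreeM0l.
  - rewrite {1}/M nc_moment_subst -/M h0 /h nc_starE.
    rewrite substD // subst_cst // addrA -cstDc [_ + (_ - _)]addrA subrK; congr (_ + _).
    rewrite subst_comp //; last exact: star_T0.
    by apply: eq_subst => x; rewrite -rhoT.
  rewrite {1}nc_moment_subst substD // subst_cst // subst_comp //; last exact: rletter0.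
  congr (_ + _); apply: eq_subst => x.
  by rewrite substM // subst_letter.
have WE x : W x = letter x * subst V (dl x (nc_eta b)).
  rewrite dl_eta subst_comp //; last exact: lletter0.
  congr (_ * _); apply: eq_subst => y; by rewrite substM // subst_letter // -MbV.
have VE' x : rho (star_u a b x) = subst W (dr x (nc_eta a)).
  rewrite dr_eta subst_comp //; last exact: rletter0.
  rewrite star_uE /rho subst_comp //; last exact: star_T0.
  apply: eq_subst => y; by rewrite substM // subst_letter // -MaW -rhoT.
have uE : forall x, rho (star_u a b x) = star_u (nc_eta a) (nc_eta b) x.
  apply: star_u_unique => x; rewrite VE' /star_op.
  by apply: eq_subst => y; rewrite WE.
have -> : nc_star (nc_eta a) (nc_eta b) = subst V (nc_eta b).
  by apply: eq_subst => x; rewrite /star_U -uE.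
have lV : subst V (1 - nc_eta b) = l.
  have : subst V (1 - nc_eta b) * M = 1.
    by rewrite {1}MbV -substM // nc_momentV subst1.
  by move=> /(congr1 (fun F => F * l)); rewrite -mulrA Ml mulr1 mul1r.
move/eqP: lV; rewrite substD // subst1 // substN // /l (inj_eq (addrI _)).
by rewrite (inj_eq oppr_inj) => /eqP.
Qed.

(* The solution of N = 1 + a N; the constant term of [a] is dropped to make the
   operator contract. *)
Definition nc_int a : ncs C T :=
  fixpt (fun (X : unit -> ncs C T) _ => 1 + (a - cst (a [::])) * X tt) tt.

Lemma nc_intE a : a [::] = 0 -> nc_int a = 1 + a * nc_int a.
Proof.
move=> a0; rewrite {1}/nc_int fixptE => [|n X Y XY _].
  by rewrite -/(nc_int a) a0 cst0 subr0.
by apply: agreeD => //; apply: agreeM0l => //; rewrite ncsDE ncsNE /= subrr.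
Qed.

Lemma nc_int_nil a : a [::] = 0 -> nc_int a [::] = 1.
Proof. by move=> a0; rewrite nc_intE // ncsDE ncsM_nil a0 mul0r addr0. Qed.

Lemma ncsM0E a M w : a [::] = 0 ->
  (a * M) w = \sum_(i < size w) a (take i.+1 w) * M (drop i.+1 w).
Proof.
move=> a0; rewrite ncsME big_ord_recl take0 a0 mul0r add0r.
by apply: eq_bigr => i _; rewrite lift0.
Qed.

(** N = 1 + b N determines b from N by induction on length: the coefficient of N at v is b(v) plus
    terms in proper prefixes and suffixes of v. These are again subsequences of [w], the only words
    where the two moment formulas are known to agree. *)
Lemma nc_int_eta a b w : b [::] = 0 ->
  (forall v, subseq v w -> nc_int b v = nc_moment a v) ->
  forall v, subseq v w -> b v = nc_eta a v.
Proof.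
move=> b0 bM v; have [n] := ubnP (size v); elim: n v => // n IH v lev vw.
have [->|v0] := eqVneq v [::]; first by rewrite nc_eta_nil.
have := bM v vw; rewrite nc_intE // nc_momentE !ncsDE !ncsM0E ?nc_eta_nil //.
move=> /addrI; have [m sv] : exists m, size v = m.+1.
  by case: (v) v0 => // x u; exists (size u).
rewrite sv !big_ord_recr /= -sv take_size drop_size nc_moment_nil mulr1.
rewrite nc_int_nil // mulr1.
suff -> : \sum_(i < m) b (take i.+1 v) * nc_int b (drop i.+1 v) =
  \sum_(i < m) nc_eta a (take i.+1 v) * nc_moment a (drop i.+1 v) by move/addrI.
apply: eq_bigr => i _; rewrite bM ?(subseq_trans (drop_subseq _ _)) //.
rewrite IH ?(subseq_trans (take_subseq _ _)) //.
by rewrite size_take_min; have := ltn_ord i; lia.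
Qed.

End Series.

(** * Coefficients of substituted series, read along a word *)

Section WordRecursion.
Variables (C : comNzRingType) (T : finType).
Implicit Types (a b F u : ncs C T) (x : T).

Definition lshift V F : ncs C T := fun w => F (V ++ w).

Lemma dl_lshift x V F : dl x (lshift V F) = lshift (rcons V x) F.
Proof. by apply: funext => w; rewrite /lshift cat_rcons. Qed.

Lemma Mletter_word u x F x0 w : (u * letter C x * F) w = \sum_(i < size w)
  (x == nth x0 w i)%:R * (u (take i w) * F (drop i.+1 w)).
Proof.
rewrite ncsME big_ord_recl take0 ncsM_nil mulr0 mul0r add0r.
by apply: eq_bigr => i _; rewrite lift0 (take_nth x0) // Mletter_rcons mulrA.
Qed.

(** U_x ends with the letter x, so the place where the first factor stops determines x. *)
Lemma subst_U_word a b F x0 w : w != [::] ->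
  subst (star_U a b) F w = \sum_(i < size w)
    star_u a b (nth x0 w i) (take i w) *
    subst (star_U a b) (dl (nth x0 w i) F) (drop i.+1 w).
Proof.
move=> w0; rewrite (substE (@star_U0 _ _ a b)) ncsDE ncs_sumE.
rewrite (_ : cst _ _ = 0) ?add0r; last by case: w w0.
under eq_bigr => x _ do rewrite (Mletter_word _ _ _ x0).
rewrite exchange_big /=; apply: eq_bigr => i _.
rewrite (bigD1 (nth x0 w i)) //= eqxx mul1r big1 ?addr0 // => x /negPf ->.
by rewrite mul0r.
Qed.

(** T_v begins with the letter v, so the first letter selects the factor, and the cut marks the end
    of b_v(U). *)
Lemma subst_T_word a b F v w :
  subst (star_T a b) F (v :: w) = \sum_(i < (size w).+1)
    subst (star_U a b) (dl v b) (take i w) *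
    subst (star_T a b) (dl v F) (drop i w).
Proof.
rewrite (substE (@star_T0 _ _ a b)) ncsDE ncs_sumE /= add0r.
under eq_bigr => x _ do rewrite -mulrA letterM_cons ncsME mulr_sumr.
rewrite exchange_big /=; apply: eq_bigr => i _.
rewrite (bigD1 v) //= eqxx mul1r big1 ?addr0 // => x /negPf ->.
by rewrite mul0r.
Qed.

End WordRecursion.

(** * Sums over non-crossing and interval partitions *)

Section PartitionSums.
Variables (R : comNzRingType) (T : finType).
Implicit Types (X : {set T}) (P : {set {set T}}).

Lemma partition_filter X1 X2 P : [disjoint X1 & X2] -> partition P (X1 :|: X2) ->
  (forall B, B \in P -> B \subset X1 \/ B \subset X2) ->
  partition [set B in P | B \subset X1] X1.
Proof.
move=> dX /and3P[/eqP cP tP P0] PX; apply/and3P; split.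
- apply/eqP/setP => x; apply/bigcupP/idP => [[B]|xX].
    by rewrite inE => /andP[_ /subsetP]; apply.
  have : x \in cover P by rewrite cP inE xX.
  case/bigcupP => B PB xB; exists B => //; rewrite inE PB /=.
  case: (PX _ PB) => // /subsetP/(_ x xB) xX2.
  by rewrite (disjointFr dX xX) in xX2.
- apply: trivIsetS tP; apply/subsetP => B; by rewrite inE => /andP[].
by rewrite inE negb_and P0.
Qed.

Lemma partitionU X1 X2 P1 P2 : [disjoint X1 & X2] ->
  partition P1 X1 -> partition P2 X2 -> partition (P1 :|: P2) (X1 :|: X2).
Proof.
move=> dX /and3P[/eqP c1 t1 n1] /and3P[/eqP c2 t2 n2]; apply/and3P; split.
- by rewrite /cover bigcup_setU -/(cover P1) -/(cover P2) c1 c2.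
- by apply: trivIsetU; rewrite // c1 c2.
by rewrite inE negb_or n1.
Qed.

Lemma block_sub X P B : partition P X -> B \in P -> B \subset X.
Proof. by move=> /and3P[/eqP <- _ _] PB; apply: (bigcup_sup B). Qed.

Lemma block_neq0 X P B : partition P X -> B \in P -> B != set0.
Proof. by move=> /and3P[_ _ P0]; apply: contraTneq => ->. Qed.

Lemma block_eq X P B B' x : partition P X -> B \in P -> B' \in P ->
  x \in B -> x \in B' -> B = B'.
Proof.
move=> /and3P[_ /trivIsetP tP _] PB PB' xB xB'; apply/eqP.
by apply: contraTT xB' => /(tP _ _ PB PB') /disjointFr ->.
Qed.

Lemma partition_disjoint X1 X2 P1 P2 : [disjoint X1 & X2] ->
  partition P1 X1 -> partition P2 X2 -> [disjoint P1 & P2].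
Proof.
move=> dX p1 p2; apply/pred0P => B /=; apply/negbTE/negP => /andP[P1B P2B].
have /set0Pn[x xB] := block_neq0 p1 P1B.
have /subsetP/(_ x xB) x1 := block_sub p1 P1B.
have /subsetP/(_ x xB) := block_sub p2 P2B.
by rewrite (disjointFr dX x1).
Qed.

Lemma prod_partitionU X1 X2 P1 P2 (F : {set T} -> R) : [disjoint X1 & X2] ->
  partition P1 X1 -> partition P2 X2 ->
  \prod_(B in P1 :|: P2) F B = (\prod_(B in P1) F B) * \prod_(B in P2) F B.
Proof.
move=> dX p1 p2; rewrite -bigU ?(partition_disjoint dX p1 p2) //.
by apply: eq_bigl => B; rewrite inE.
Qed.

(** Union and filtering are inverse bijections between pairs of partitions and partitions with no
    block straddling X1 and X2. *)
Lemma sum_split X1 X2 (A A1 A2 : pred {set {set T}}) (f : {set {set T}} -> R) :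
  [disjoint X1 & X2] ->
  (forall P, A P -> partition P (X1 :|: X2) /\
    forall B, B \in P -> B \subset X1 \/ B \subset X2) ->
  (forall P, A1 P -> partition P X1) -> (forall P, A2 P -> partition P X2) ->
  (forall P1 P2, partition P1 X1 -> partition P2 X2 ->
    A (P1 :|: P2) = A1 P1 && A2 P2) ->
  \sum_(P | A P) f P = \sum_(P1 | A1 P1) \sum_(P2 | A2 P2) f (P1 :|: P2).
Proof.
move=> dX pA pA1 pA2 AE; rewrite pair_big_dep /=.
pose h (p : {set {set T}} * {set {set T}}) := p.1 :|: p.2.
pose h' P : {set {set T}} * {set {set T}} :=
  ([set B in P | B \subset X1], [set B in P | B \subset X2]).
have hK P1 P2 : partition P1 X1 -> partition P2 X2 -> h' (P1 :|: P2) = (P1, P2).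
  move=> p1 p2; congr (_, _); apply/setP => B; rewrite !inE.
    apply/andP/idP => [[/orP[//|P2B] BX1]|P1B]; last by rewrite P1B (block_sub p1).
    have /set0Pn[x xB] := block_neq0 p2 P2B.
    have := subsetP (block_sub p2 P2B) x xB.
    by rewrite (disjointFr dX (subsetP BX1 x xB)).
  apply/andP/idP => [[/orP[P1B|//] BX2]|P2B]; last by rewrite P2B orbT (block_sub p2).
  have /set0Pn[x xB] := block_neq0 p1 P1B.
  have := subsetP BX2 x xB.
  by rewrite (disjointFr dX (subsetP (block_sub p1 P1B) x xB)).
rewrite (reindex_onto h h') => [|P /pA[_ PX]]; last first.
  apply/setP => B; rewrite !inE -andb_orr.
  apply/andP/idP => [[]//|PB]; split=> //; apply/orP; exact: PX.
apply: eq_bigl => -[P1 P2] /=; apply/andP/andP => [[APU /eqP [E1 E2]]|[A1P A2P]].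
  have [pU sU] := pA _ APU.
  have p1 : partition P1 X1 by rewrite -E1; apply: partition_filter dX pU sU.
  have p2 : partition P2 X2.
    rewrite -E2; apply: (@partition_filter X2 X1); first by rewrite disjoint_sym.
      by rewrite setUC.
    by move=> B /sU[]; [right | left].
  by apply/andP; rewrite -AE.
have p1 := pA1 _ A1P; have p2 := pA2 _ A2P.
by rewrite /h /= AE // A1P A2P hK.
Qed.

Lemma sum_split_prod X1 X2 (A A1 A2 : pred {set {set T}}) (f f1 f2 : {set {set T}} -> R) :
  [disjoint X1 & X2] ->
  (forall P, A P -> partition P (X1 :|: X2) /\
    forall B, B \in P -> B \subset X1 \/ B \subset X2) ->
  (forall P, A1 P -> partition P X1) -> (forall P, A2 P -> partition P X2) ->
  (forall P1 P2, partition P1 X1 -> partition P2 X2 ->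
    A (P1 :|: P2) = A1 P1 && A2 P2) ->
  (forall P1 P2, A1 P1 -> A2 P2 -> f (P1 :|: P2) = f1 P1 * f2 P2) ->
  \sum_(P | A P) f P = (\sum_(P | A1 P) f1 P) * (\sum_(P | A2 P) f2 P).
Proof.
move=> dX pA pA1 pA2 AE fE; rewrite (sum_split _ dX pA pA1 pA2 AE) big_distrlr /=.
by apply: eq_bigr => P1 AP1; apply: eq_bigr => P2 AP2; apply: fE.
Qed.

(** In the uses below, [j] records where a distinguished block stops, or where it goes on; each
    partition determines it. *)
Lemma sum_unique (I J : finType) (Q : pred I) (E : J -> pred I) (f : I -> R) :
  (forall i, Q i -> exists j, forall k, E k i = (k == j)) ->
  \sum_(i | Q i) f i = \sum_j \sum_(i | Q i && E j i) f i.
Proof.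
move=> QE; rewrite (exchange_big_dep Q) /= => [|j i _ /andP[]//].
apply: eq_bigr => i Qi; have [j Ej] := QE i Qi.
by rewrite (big_pred1 j) // => k; rewrite Qi Ej.
Qed.

Section Fibres.
Variables (V : finType) (G : {set T} -> R).
Implicit Types (f g : T -> V) (Z : {set T}).

Lemma preim_partitionE f Z :
  preim_partition f Z = [set [set y in Z | f x == f y] | x in Z].
Proof. by []. Qed.

Lemma eq_preim_partition (V' : finType) f (g : T -> V') Z :
  {in Z &, forall x y, (f x == f y) = (g x == g y)} ->
  preim_partition f Z = preim_partition g Z.
Proof.
move=> fg; apply: eq_in_imset => x xZ; apply/setP => y; rewrite !inE.
by case: (boolP (y \in Z)) => //= yZ; apply: fg.
Qed.

Lemma prod_preimU f Z1 Z2 : (forall x y, x \in Z1 -> y \in Z2 -> f x != f y) ->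
  \prod_(B in preim_partition f (Z1 :|: Z2)) G B =
  (\prod_(B in preim_partition f Z1) G B) * (\prod_(B in preim_partition f Z2) G B).
Proof.
move=> fZ.
have dZ : [disjoint Z1 & Z2].
  apply/pred0P => x /=; apply/negbTE/negP => /andP[x1 x2].
  by have := fZ x x x1 x2; rewrite eqxx.
rewrite -(prod_partitionU G dZ) ?preim_partitionP //.
apply: eq_bigl => B; congr (B \in _).
rewrite !preim_partitionE imsetU; congr (_ :|: _).
  apply: eq_in_imset => x xZ; apply/setP => y; rewrite !inE.
  case: (boolP (y \in Z1)) => //= _; case: (boolP (y \in Z2)) => //= yZ.
  exact/negbTE/fZ.
apply: eq_in_imset => x xZ; apply/setP => y; rewrite !inE.
case: (boolP (y \in Z2)) => //= yZ2; first by rewrite orbT.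
rewrite orbF; case: (boolP (y \in Z1)) => //= yZ; rewrite eq_sym.
exact/negbTE/fZ.
Qed.

Lemma prod_preim_fibre f Z v : v \in Z ->
  \prod_(B in preim_partition f Z) G B =
  G [set z in Z | f z == f v] *
  \prod_(B in preim_partition f [set z in Z | f z != f v]) G B.
Proof.
move=> vZ; set Z1 := [set z in Z | f z == f v]; set Z2 := [set z in Z | f z != f v].
have -> : Z = Z1 :|: Z2 by apply/setP => z; rewrite !inE -andb_orr orbN andbT.
rewrite prod_preimU => [|x y]; last first.
  by rewrite !inE => /andP[_ /eqP ->] /andP[_]; rewrite eq_sym.
congr (_ * _); rewrite (_ : preim_partition f Z1 = [set Z1]) ?big_set1 //.
apply/setP => B; rewrite inE; apply/imsetP/eqP => [[x xZ1 ->]|->].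
  apply/setP => y; rewrite !inE; move: xZ1; rewrite inE => /andP[_ /eqP ->].
  by case: (y \in Z) => //=; rewrite [f v == _]eq_sym andbb.
exists v; first by rewrite inE vZ eqxx.
apply/setP => y; rewrite !inE.
by case: (y \in Z) => //=; rewrite [f v == _]eq_sym andbb.
Qed.

End Fibres.
End PartitionSums.

(** * Recursions for sums over non-crossing and interval partitions *)

Section Noncrossing.
Variables (R : comNzRingType) (T : finType) (r : T -> nat).
Hypothesis r_inj : injective r.
Implicit Types (X B : {set T}) (P : {set {set T}}) (s V W : seq T) (x y z v : T).

Definition rlt : rel T := fun x y => (r x < r y)%N.

Lemma head_min y s p : pairwise rlt (rcons s y) -> p \in rcons s y ->
  (r (head y s) <= r p)%N.
Proof.
case: s => [|v s] /=; first by rewrite inE => _ /eqP ->.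
move=> /andP[/allP lts _]; rewrite in_cons => /orP[/eqP -> //|ps].
exact/ltnW/lts.
Qed.

Lemma noncrossingP P : reflect (forall B D a b c d, B \in P -> D \in P -> B != D ->
  a \in B -> b \in D -> c \in B -> d \in D -> ~~ [&& rlt a b, rlt b c & rlt c d])
  (noncrossing rlt P).
Proof.
apply: (iffP forall_inP) => [nc B D a b c d PB PD BD aB bD cB dD | nc B PB].
  move: (nc B PB) => /forall_inP/(_ D PD)/implyP/(_ BD).
  move=> /forall_inP/(_ a aB)/forall_inP/(_ b bD)/forall_inP/(_ c cB).
  by move=> /forall_inP/(_ d dD).
apply/forall_inP => D PD; apply/implyP => BD.
apply/forall_inP => a aB; apply/forall_inP => b bD; apply/forall_inP => c cB.
apply/forall_inP => d dD; exact: (nc B D).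
Qed.

(** X2 lies in a gap of X1-free letters or around X1: in either alternating pattern of two blocks
    from different sides, two points of X1 would surround one of X2. *)
Lemma noncrossingU X1 X2 P1 P2 :
  (forall a b c, a \in X1 -> c \in X1 -> b \in X2 -> ~~ (rlt a b && rlt b c)) ->
  partition P1 X1 -> partition P2 X2 ->
  noncrossing rlt (P1 :|: P2) = noncrossing rlt P1 && noncrossing rlt P2.
Proof.
move=> cv p1 p2; apply/noncrossingP/andP => [nc|[/noncrossingP n1 /noncrossingP n2]].
  split; apply/noncrossingP => B D a b c d PB PD; apply: nc;
    by rewrite inE ?PB ?PD ?orbT.
have sub1 B x : B \in P1 -> x \in B -> x \in X1.
  by move=> /(block_sub p1)/subsetP; apply.
have sub2 B x : B \in P2 -> x \in B -> x \in X2.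
  by move=> /(block_sub p2)/subsetP; apply.
move=> B D a b c d; rewrite !inE => /orP[PB|PB] /orP[PD|PD] BD aB bD cB dD.
- exact: (n1 B D).
- have := cv a b c (sub1 _ _ PB aB) (sub1 _ _ PB cB) (sub2 _ _ PD bD).
  by apply: contra => /and3P[-> ->].
- have := cv b c d (sub1 _ _ PD bD) (sub1 _ _ PD dD) (sub2 _ _ PB cB).
  by apply: contra => /and3P[_ -> ->].
exact: (n2 B D).
Qed.

Definition ncpart X : pred {set {set T}} :=
  fun P => partition P X && noncrossing rlt P.

(* Two barred points lie in the same block of the Kreweras complement of [P] iff
   they separate the same pairs of [P]-related points; [z] stands for bar z, which
   comes right after z. *)
Definition cut P z : {set T * T} :=
  [set pq | (r pq.1 <= r z < r pq.2)%N &&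
            [exists B in P, (pq.1 \in B) && (pq.2 \in B)]].

Lemma cutP P z p q : reflect
  ((r p <= r z < r q)%N /\ exists2 B, B \in P & (p \in B) && (q \in B))
  ((p, q) \in cut P z).
Proof.
rewrite inE /=; apply: (iffP andP) => [[-> /exists_inP]|[-> h]] //.
by split=> //; apply/exists_inP.
Qed.

Lemma cutU P1 P2 z : cut (P1 :|: P2) z = cut P1 z :|: cut P2 z.
Proof.
apply/setP => -[p q]; rewrite in_setU; apply/cutP/orP => [[h [B + pq]]|].
  by rewrite inE => /orP[] PB; [left|right]; apply/cutP; split=> //; exists B.
by case=> /cutP[h [B PB pq]]; split=> //; exists B => //; rewrite inE PB ?orbT.
Qed.

Lemma cut_sub X P z p q : partition P X -> (p, q) \in cut P z -> p \in X /\ q \in X.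
Proof.
move=> pP /cutP[_ [B PB /andP[pB qB]]].
by split; apply: (subsetP (block_sub pP PB)).
Qed.

Lemma cut0_lt X P z : partition P X -> {in X, forall p, rlt z p} -> cut P z = set0.
Proof.
move=> pP zX; apply/setP => -[p q]; rewrite in_set0; apply/negP => h.
have [pX _] := cut_sub pP h; move/cutP: h => [/andP[+ _] _].
by have := zX p pX; rewrite /rlt ltnNge => /negPf ->.
Qed.

Lemma cut0_ge X P z : partition P X -> {in X, forall q, r q <= r z}%N -> cut P z = set0.
Proof.
move=> pP zX; apply/setP => -[p q]; rewrite in_set0; apply/negP => h.
have [_ qX] := cut_sub pP h; move/cutP: h => [/andP[_ +] _].
by rewrite ltnNge zX.
Qed.

Variables (F G : {set T} -> R).

(* [W] lists the part already read of a block of the complement that the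
   complement restricted to [s] may still extend. *)
Definition open_sum W s : R := \sum_(P | ncpart [set x in s] P)
  (\prod_(B in P) F B) *
  (G ([set x in W] :|: [set z in s | cut P z == set0]) *
   \prod_(B in preim_partition (cut P) [set z in s | cut P z != set0]) G B).

Definition in_block P V x y :=
  [exists B in P, [&& [set z in V] \subset B, x \in B & y \in B]].

(* [V] is the part already read of a block of the partition, which goes on with
   the first letter of [rcons s x] and ends at [x]; the bars of [V] and of [x] are
   left out of the complement. *)
Definition closed_sum V s x : R :=
  \sum_(P | ncpart [set z in V ++ rcons s x] P && in_block P V (head x s) x)
  (\prod_(B in P) F B) * \prod_(B in preim_partition (cut P) [set z in s]) G B.

Lemma open_sum_nil W : open_sum W [::] = G [set x in W].
Proof.
rewrite /open_sum (big_pred1 set0) => [|P]; last first.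
  rewrite /ncpart (_ : [set x in [::]] = set0); last by apply/setP => x; rewrite !inE.
  rewrite partition_set0 /=; case: eqP => [->|] //=; apply/noncrossingP => B D a b c d.
  by rewrite inE.
have e0 (Q : pred T) : [set z in [::] | Q z] = set0.
  by apply/setP => x; rewrite !inE.
rewrite big_set0 mul1r !e0 setU0.
by rewrite preim_partitionE imset0 big_set0 mulr1.
Qed.

Lemma closed_sum_nil V x : closed_sum V [::] x = F [set z in rcons V x].
Proof.
rewrite /closed_sum (big_pred1 [set [set z in rcons V x]]) => [|P].
  rewrite big_set1 (_ : [set z in [::]] = set0); last by apply/setP => z; rewrite !inE.
  by rewrite preim_partitionE imset0 big_set0 mulr1.
rewrite /= cats1; set X := [set z in rcons V x]; apply/andP/eqP => [[/andP[pP _]]|->].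
  case/exists_inP => B PB /and3P[VB xB _].
  have BX : B = X.
    apply/eqP; rewrite eqEsubset (block_sub pP PB); apply/subsetP => z.
    rewrite inE mem_rcons in_cons => /orP[/eqP -> //|zV].
    by apply: (subsetP VB); rewrite inE.
  apply/setP => D; rewrite inE; apply/idP/eqP => [PD|->]; last by rewrite -BX.
  have /set0Pn[d dD] := block_neq0 pP PD.
  rewrite -BX; apply: (block_eq pP PD PB dD).
  by rewrite BX; apply: (subsetP (block_sub pP PD)).
have xX : x \in X by rewrite inE mem_rcons mem_head.
split.
  apply/andP; split; last first.
    by apply/noncrossingP => B D a b c d; rewrite !inE => /eqP -> /eqP ->; rewrite eqxx.
  apply/and3P; split; first by rewrite /cover big_set1.
    by apply/trivIsetP => B D /set1P -> /set1P ->; rewrite eqxx.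
  by rewrite inE eq_sym; apply/set0Pn; exists x.
apply/exists_inP; exists X; first by rewrite inE.
rewrite xX andbT /= andbT; apply/subsetP => z.
by rewrite !inE mem_rcons in_cons => ->; rewrite orbT.
Qed.

(** With [s] the letters after y, this makes y the last element of the block of x; with [s] the
    letters between x and y, it makes y the next one. *)
Definition joined_off P x y s :=
  [exists B in P, [&& x \in B, y \in B & [disjoint B & s]]].

(** The block of the first letter h ends at y, so no other block passes over y. Bars of s1 are shut
    in under this block, bar y joins the open block, and s2 is free. *)
Lemma open_sum_split W s1 y s2 : pairwise rlt (s1 ++ y :: s2) ->
  \sum_(P | ncpart [set x in s1 ++ y :: s2] P && joined_off P (head y s1) y s2)
    (\prod_(B in P) F B) *
    (G ([set x in W] :|: [set z in s1 ++ y :: s2 | cut P z == set0]) *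
     \prod_(B in preim_partition (cut P) [set z in s1 ++ y :: s2 | cut P z != set0]) G B)
  = closed_sum [::] s1 y * open_sum (rcons W y) s2.
Proof.
rewrite pairwise_cat /= => /and3P[/allrelP lt12 pw1 /andP[/allP lty _]].
set h := head y s1.
pose X1 := [set x in rcons s1 y]; pose X2 := [set x in s2].
have ltX p q : p \in X1 -> q \in X2 -> rlt p q.
  rewrite !inE mem_rcons in_cons => /orP[/eqP ->|p1] q2; first exact: lty.
  by apply: lt12; rewrite ?in_cons ?q2 ?orbT.
have EX : [set x in s1 ++ y :: s2] = X1 :|: X2.
  by apply/setP => x; rewrite !inE mem_cat mem_rcons !in_cons orbCA orbA.
have dX : [disjoint X1 & X2].
  apply/pred0P => x /=; apply/negbTE/negP => /andP[x1 x2].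
  by have := ltX x x x1 x2; rewrite /rlt ltnn.
have yX : y \in X1 by rewrite inE mem_rcons mem_head.
have hX : h \in X1.
  by rewrite inE /h; case: (s1) => [|v s] /=; rewrite mem_head.
have ymax p : p \in X1 -> (r p <= r y)%N.
  rewrite inE mem_rcons in_cons => /orP[/eqP -> //|p1].
  by apply/ltnW/lt12; rewrite ?mem_head.
have hmin p : p \in X1 -> (r h <= r p)%N.
  rewrite inE; apply: head_min; rewrite -cats1 pairwise_cat pw1 /= andbT.
  by apply/allrelP => u v u1; rewrite inE => /eqP ->; apply: lt12; rewrite ?mem_head.
have r_lt p q : p != q -> (r p <= r q)%N -> rlt p q.
  by move=> pq le; rewrite /rlt ltn_neqAle le andbT (inj_eq r_inj).
rewrite EX; apply: (sum_split_prod dX).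
- move=> P /andP[/andP[pP /noncrossingP nc] /exists_inP[B0 PB0 /and3P[hB yB dB]]].
  split=> // B PB; case: (eqVneq B0 B) => [<-|neB].
    left; apply/subsetP => z zB; have := subsetP (block_sub pP PB0) z zB.
    by rewrite inE [z \in X2]inE (disjointFr dB zB) orbF.
  case: (boolP [disjoint B & X1]) => [dB1|/pred0Pn[p /andP[/= pB p1]]].
    right; apply/subsetP => z zB; have := subsetP (block_sub pP PB) z zB.
    by rewrite inE (disjointFr dB1 zB).
  (* A block with p before y and q after it would give the crossing h < p < y < q. *)
  left; apply/subsetP => q qB; have := subsetP (block_sub pP PB) q qB.
  rewrite inE => /orP[//|q2]; have := nc _ _ h p y q PB0 PB neB hB pB yB qB.
  have neqB z : z \in B0 -> z != p.
    move=> zB; apply: contraNneq neB => zp; rewrite zp in zB.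
    by rewrite (block_eq pP PB0 PB zB pB).
  rewrite (ltX y q) // !r_lt ?hmin ?ymax // ?neqB // eq_sym.
  exact: neqB.
- by move=> P /andP[/andP[]].
- by move=> P /andP[].
- move=> P1 P2 p1 p2; rewrite /ncpart p1 p2 partitionU //= (noncrossingU _ p1 p2).
    rewrite -andbA [RHS]andbAC -andbA; congr (_ && _); congr (_ && _).
    apply/exists_inP/exists_inP => -[B PB /and3P[hB yB dB]]; last first.
      exists B; first by rewrite inE PB.
      rewrite yB dB /=; apply/pred0P => z /=; apply/negbTE/negP => /andP[zB z2].
      have := subsetP (block_sub p1 PB) z zB.
      by rewrite (disjointFl dX) // inE.
    exists B; last by rewrite hB yB !andbT; apply/subsetP => z; rewrite !inE.
    move: PB; rewrite inE => /orP[//|PB].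
    by have := subsetP (block_sub p2 PB) y yB; rewrite (disjointFr dX yX).
  move=> a b c a1 c1 b2; have := ltX c b c1 b2; rewrite /rlt => lt.
  by rewrite negb_and -[in X in _ || X]leqNgt (ltnW lt) orbT.
move=> P1 P2 /andP[/andP[p1 _] /exists_inP[B0 PB0 /and3P[_ hB yB]]] /andP[p2 _].
rewrite -/h in hB; set P := P1 :|: P2.
have cut1 z : z \in X1 -> cut P z = cut P1 z.
  move=> z1; rewrite cutU (cut0_lt p2) ?setU0 // => p; exact: ltX.
have cut2 z : z \in X2 -> cut P z = cut P2 z.
  move=> z2; rewrite cutU (cut0_ge p1) ?set0U // => q q1; exact/ltnW/ltX.
have cuty : cut P y = set0 by rewrite cut1 // (cut0_ge p1).
(* The pair (h, y) is separated by every bar of s1 and by none from bar y on, so no complement block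
   mixes the two sorts. *)
have cuts1 z : z \in s1 -> (h, y) \in cut P z.
  have zX : z \in s1 -> z \in X1 by rewrite inE mem_rcons in_cons orbC => ->.
  move=> z1; rewrite cut1 ?zX //; apply/cutP; split; last by exists B0; rewrite ?hB.
  by apply/andP; split; [exact: hmin (zX z1) | apply: lt12; rewrite ?mem_head].
have cutn z : z \in s1 -> (cut P z == set0) = false.
  by move=> /cuts1 hy; apply/negbTE/set0Pn; exists (h, y).
have s12 z : z \in s1 -> (z \in s2) = false.
  move=> z1; have z1X : z \in X1 by rewrite inE mem_rcons in_cons z1 orbT.
  by have := disjointFr dX z1X; rewrite inE.
have -> : [set x in W] :|: [set z in s1 ++ y :: s2 | cut P z == set0] =
    [set x in rcons W y] :|: [set z in s2 | cut P2 z == set0].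
  apply/setP => z; rewrite !inE mem_cat mem_rcons !in_cons.
  case: (eqVneq z y) => [->|_] /=; first by rewrite cuty eqxx !orbT.
  case: (boolP (z \in s1)) => [z1|_] /=; first by rewrite cutn // s12.
  by case: (boolP (z \in s2)) => //= z2; rewrite cut2 // inE.
have -> : [set z in s1 ++ y :: s2 | cut P z != set0] =
    [set z in s1] :|: [set z in s2 | cut P2 z != set0].
  apply/setP => z; rewrite !inE mem_cat in_cons.
  case: (eqVneq z y) => [->|_] /=.
    have y1 : (y \in s1) = false by apply/negP => /cutn; rewrite cuty eqxx.
    have y2 : (y \in s2) = false by have := disjointFr dX yX; rewrite inE.
    by rewrite y1 y2 cuty eqxx.
  case: (boolP (z \in s1)) => [z1|_] /=; first by rewrite cutn.
  by case: (boolP (z \in s2)) => //= z2; rewrite cut2 // inE.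
rewrite (prod_partitionU F dX p1 p2) prod_preimU => [|u v]; last first.
  rewrite !inE => u1 /andP[v2 _]; apply: contraTneq (cuts1 u u1) => ->.
  rewrite cut2; last by rewrite inE.
  apply/negP => hy; have [_ y2] := cut_sub p2 hy.
  by rewrite (disjointFr dX yX) in y2.
rewrite (eq_preim_partition (g := cut P1) (Z := [set z in s1])).
  rewrite (eq_preim_partition (g := cut P2) (Z := [set z in s2 | _])).
    rewrite -!mulrA; congr (_ * _); rewrite [RHS]mulrCA; congr (_ * _).
    exact: mulrCA.
  by move=> u v; rewrite !inE => /andP[u2 _] /andP[v2 _]; rewrite !cut2 ?inE.
by move=> u v; rewrite !inE => u1 v1; rewrite !cut1 // inE mem_rcons in_cons ?u1 ?v1 orbT.
Qed.

(** Partitions are classified by the last element of the block of the first letter; the recursion is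
    that of [subst_U_word]. *)
Lemma open_sum_cons W s x0 : s != [::] -> pairwise rlt s ->
  open_sum W s = \sum_(i < size s)
    closed_sum [::] (take i s) (nth x0 s i) *
    open_sum (rcons W (nth x0 s i)) (drop i.+1 s).
Proof.
move=> s0 pw; have sE (i : 'I_(size s)) :
    s = take i s ++ nth x0 s i :: drop i.+1 s.
  by rewrite -drop_nth // cat_take_drop.
transitivity (\sum_(i < size s) \sum_(P | ncpart [set x in s] P &&
  joined_off P (head x0 s) (nth x0 s i) (drop i.+1 s))
  (\prod_(B in P) F B) *
  (G ([set x in W] :|: [set z in s | cut P z == set0]) *
   \prod_(B in preim_partition (cut P) [set z in s | cut P z != set0]) G B)).
  apply: sum_unique => P /andP[pP _].
  have : head x0 s \in cover P.
    have /and3P[/eqP -> _ _] := pP; rewrite inE.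
    by case: (s) s0 => // v s' _; apply: mem_head.
  case/bigcupP => B PB hB.
  have us : uniq s.
    by apply: pairwise_uniq pw => x; rewrite /rlt ltnn.
  have s_gt0 : (0 < size s)%N by case: (s) s0.
  have h0 : nth x0 s (Ordinal s_gt0) \in B by rewrite /= nth0.
  exists [arg max_(i > Ordinal s_gt0 | nth x0 s i \in B) i].
  case: arg_maxnP => // j jB jmax k.
  apply/exists_inP/eqP => [[D PD /and3P[hD kD dD]]|->].
    have DB : D = B by apply: block_eq pP PD PB hD hB.
    rewrite DB in kD dD; apply/eqP; rewrite -val_eqE eqn_leq.
    apply/andP; split; first exact: jmax.
    rewrite leqNgt; apply/negP => kj.
    have := disjointFr dD jB; rewrite -[j : nat](subnKC kj) -nth_drop mem_nth //.
    rewrite size_drop; have := ltn_ord j; move: kj => /=; lia.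
  exists B => //; rewrite hB jB /=; apply/pred0P => z /=; apply/negbTE/negP.
  move=> /andP[zB /(nthP x0)[m]]; rewrite size_drop => lt; rewrite nth_drop => zE.
  have ltm : (j.+1 + m < size s)%N by rewrite -ltn_subRL.
  have := jmax (Ordinal ltm); rewrite /= zE => /(_ zB).
  by rewrite /= addSn leqNgt ltnS leq_addr.
apply: eq_bigr => i _; set y := nth x0 s i.
have := @open_sum_split W (take i s) y (drop i.+1 s); rewrite -sE => <- //.
suff -> : head y (take i s) = head x0 s by [].
by rewrite [in RHS](sE i); case: (take i s).
Qed.

(** Here y follows v in its block. The letters s1 in between are partitioned on their own; their
    visible bars form one complement block with bar v, and the block goes on from y. *)
Lemma closed_sum_split V v s1 s2 x : pairwise rlt (V ++ rcons (v :: s1 ++ s2) x) ->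
  \sum_(P | (ncpart [set z in V ++ rcons (v :: s1 ++ s2) x] P && in_block P V v x)
             && joined_off P v (head x s2) s1)
    (\prod_(B in P) F B) *
    \prod_(B in preim_partition (cut P) [set z in v :: s1 ++ s2]) G B
  = open_sum [:: v] s1 * closed_sum (rcons V v) s2 x.
Proof.
rewrite -[V ++ _](_ : rcons V v ++ s1 ++ rcons s2 x = _); last first.
  by rewrite cat_rcons rcons_cons rcons_cat.
rewrite !pairwise_cat => /and3P[/allrelP ltV pwV /and3P[/allrelP lt12 _ pw2]].
set y := head x s2.
pose X1 := [set z in s1]; pose X2 := [set z in rcons V v ++ rcons s2 x].
have vV : v \in rcons V v by rewrite mem_rcons mem_head.
have ys : y \in rcons s2 x by rewrite /y; case: (s2) => [|u s] /=; rewrite mem_head.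
have ymin q : q \in rcons s2 x -> (r y <= r q)%N by apply: head_min.
have vmax p : p \in rcons V v -> (r p <= r v)%N.
  move: pwV; rewrite -cats1 pairwise_cat mem_cat => /and3P[/allrelP lt _ _].
  case/orP => [pV|]; last by rewrite inE => /eqP ->.
  by apply/ltnW/lt; rewrite ?mem_head.
have ltV1 p q : p \in rcons V v -> q \in s1 -> rlt p q.
  by move=> pV q1; apply: ltV; rewrite ?mem_cat ?q1.
have ltV2 p q : p \in rcons V v -> q \in rcons s2 x -> rlt p q.
  by move=> pV q2; apply: ltV; rewrite ?mem_cat ?q2 ?orbT.
have X2P q : q \in X2 -> q \in rcons V v \/ q \in rcons s2 x.
  by rewrite inE mem_cat => /orP.
have dX : [disjoint X1 & X2].
  apply/pred0P => z /=; apply/negbTE/negP => /andP[]; rewrite inE => z1 /X2P[z2|z2].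
    by have := ltV1 z z z2 z1; rewrite /rlt ltnn.
  by have := lt12 z z z1 z2; rewrite /rlt ltnn.
have vX : v \in X2 by rewrite inE mem_cat vV.
have EX : [set z in rcons V v ++ s1 ++ rcons s2 x] = X1 :|: X2.
  by apply/setP => z; rewrite !inE !mem_cat orbCA.
have r_lt p q : p != q -> (r p <= r q)%N -> rlt p q.
  by move=> pq le; rewrite /rlt ltn_neqAle le andbT (inj_eq r_inj).
rewrite EX; apply: (sum_split_prod dX).
- move=> P /andP[/andP[/andP[pP /noncrossingP nc]]].
  case/exists_inP=> B0 PB0 /and3P[VB vB xB] /exists_inP[D PD /and3P[vD yD dD]].
  have DB := block_eq pP PD PB0 vD vB; rewrite DB in yD dD.
  split=> // B PB; case: (eqVneq B0 B) => [<-|neB].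
    right; apply/subsetP => z zB; have := subsetP (block_sub pP PB0) z zB.
    by rewrite in_setU [z \in X1]inE (disjointFr dD zB).
  case: (boolP [disjoint B & X1]) => [dB1|/pred0Pn[p /andP[/= pB p1]]].
    right; apply/subsetP => z zB; have := subsetP (block_sub pP PB) z zB.
    by rewrite in_setU (disjointFr dB1 zB).
  left; apply/subsetP => q qB; have := subsetP (block_sub pP PB) q qB.
  rewrite in_setU => /orP[//|q2].
  have nB z : z \in B0 -> z != q.
    move=> zB; apply: contraNneq neB => zq; rewrite zq in zB.
    by rewrite (block_eq pP PB0 PB zB qB).
  rewrite inE in p1; case/X2P: q2 => [|q2].
    rewrite mem_rcons in_cons => /orP[/eqP qv|qV].
      by have := nB v vB; rewrite qv eqxx.
    have qB0 : q \in B0 by apply: (subsetP VB); rewrite inE.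
    by have := nB q qB0; rewrite eqxx.
  have := nc _ _ v p y q PB0 PB neB vB pB yD qB.
  by rewrite (ltV1 v p) // (lt12 p y) // r_lt ?ymin // nB.
- by move=> P /andP[].
- by move=> P /andP[/andP[]].
- move=> P1 P2 p1 p2; have pU := partitionU dX p1 p2.
  rewrite /ncpart p1 p2 pU /= (noncrossingU _ p1 p2); last first.
    move=> a b c a1 c1 /X2P[b2|b2]; move: a1 c1; rewrite !inE negb_and => a1 c1.
      by have := ltV1 b a b2 a1; rewrite /rlt => /ltnW; rewrite leqNgt => ->.
    by have := lt12 c b c1 b2; rewrite /rlt => /ltnW; rewrite orbC leqNgt => ->.
  rewrite -!andbA; congr (_ && _); congr (_ && _).
  apply/andP/exists_inP => [[/exists_inP[B PB /and3P[VB vB xB]]]|].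
    case/exists_inP=> D PD /and3P[vD yD dD].
    have DB := block_eq pU PD PB vD vB; rewrite DB in yD dD.
    exists B; last first.
      rewrite yD xB !andbT; apply/subsetP => z.
      rewrite inE mem_rcons in_cons => /orP[/eqP -> //|zV].
      by apply: (subsetP VB); rewrite inE.
    move: PB; rewrite inE => /orP[PB|//].
    by have := subsetP (block_sub p1 PB) v vB; rewrite (disjointFl dX vX).
  case=> B PB /and3P[VB yB xB].
  have vB : v \in B by apply: (subsetP VB); rewrite inE.
  split; apply/exists_inP; exists B; rewrite ?inE ?PB ?orbT //.
    rewrite vB xB !andbT; apply/subsetP => z; rewrite inE => zV.
    by apply: (subsetP VB); rewrite inE mem_rcons in_cons zV orbT.
  rewrite vB yB /=; apply/pred0P => z /=; apply/negbTE/negP => /andP[zB z1].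
  have := subsetP (block_sub p2 PB) z zB.
  by rewrite (disjointFr dX) // inE.
move=> P1 P2 /andP[p1 _] /andP[/andP[p2 _] /exists_inP[B0 PB0 /and3P[VB yB xB]]].
have vB : v \in B0 by apply: (subsetP VB); rewrite inE.
set P := P1 :|: P2; pose A := v |: [set z in s1].
have cutv : cut P1 v = set0.
  by apply: (cut0_lt p1) => p; rewrite inE => p1'; apply: ltV1.
have leA z : z \in A -> (r v <= r z)%N.
  by rewrite !inE => /orP[/eqP -> //|z1]; apply/ltnW/ltV1.
have ltA z q : z \in A -> q \in rcons s2 x -> rlt z q.
  by rewrite !inE => /orP[/eqP ->|z1] q2; [apply: ltV2 | apply: lt12].
(* All bars of A lie in one gap of X2, so P2 contributes the same set to each of their cuts: on A
   the complement depends on P1 alone. *)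
have cutA z : z \in A -> cut P z = cut P1 z :|: cut P2 v.
  move=> zA; rewrite cutU; congr (_ :|: _); apply/setP => -[p q].
  apply/cutP/cutP => -[h [B PB /andP[pB qB]]]; split; try by exists B; rewrite ?pB.
    have qX := subsetP (block_sub p2 PB) q qB.
    have pX := subsetP (block_sub p2 PB) p pB.
    case/andP: h => h1 h2; apply/andP; split.
      case/X2P: pX => [|pX]; first exact: vmax.
      by have := ltA z p zA pX; rewrite /rlt ltnNge h1.
    exact: leq_ltn_trans (leA z zA) h2.
  have qX := subsetP (block_sub p2 PB) q qB.
  case/andP: h => h1 h2; apply/andP; split; first exact: leq_trans h1 (leA z zA).
  case/X2P: qX => qX; first by have := vmax q qX; rewrite leqNgt h2.
  exact: ltA.
have cutA1 z : z \in A -> cut P1 z = cut P z :\: cut P2 v.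
  move=> zA; rewrite cutA // setDUl setDv setU0; apply/esym/setDidPl.
  apply/pred0P => -[p q] /=; apply/negbTE/negP => /andP[h1 h2].
  have [pX1 _] := cut_sub p1 h1; have [pX2 _] := cut_sub p2 h2.
  by rewrite (disjointFr dX pX1) in pX2.
have cutB z : z \in s2 -> cut P z = cut P2 z.
  move=> z2; rewrite cutU (cut0_ge p1) ?set0U // => q; rewrite inE => q1.
  by apply/ltnW/lt12; rewrite // mem_rcons in_cons z2 orbT.
(* The pair (v, y) tells the bars of A from those of s2. *)
have vy z : z \in A -> (v, y) \in cut P z.
  move=> zA; rewrite cutA // in_setU; apply/orP; right; apply/cutP.
  by split; [rewrite leqnn; apply: ltV2 | exists B0; rewrite ?vB].
have vyN z : z \in s2 -> (v, y) \notin cut P2 z.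
  move=> z2; apply/negP => /cutP[/andP[_ +] _]; rewrite ltnNge ymin //.
  by rewrite mem_rcons in_cons z2 orbT.
have -> : [set z in v :: s1 ++ s2] = A :|: [set z in s2].
  by apply/setP => z; rewrite !inE mem_cat orbA.
rewrite prod_preimU => [|u w uA]; last first.
  rewrite inE => w2; apply: contraTneq (vy u uA) => ->.
  by rewrite cutB // vyN.
rewrite (prod_partitionU F dX p1 p2).
rewrite (eq_preim_partition (g := cut P1) (Z := A)) => [|u w uA wA]; last first.
  apply/eqP/eqP => E; first by rewrite !cutA1 ?E.
  by rewrite !cutA ?E.
rewrite (eq_preim_partition (g := cut P2) (Z := [set z in s2])) => [|u w]; last first.
  by rewrite !inE => u2 w2; rewrite !cutB.
rewrite (@prod_preim_fibre _ _ _ G (cut P1) A v) ?setU11 // cutv.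
have -> : [set z in A | cut P1 z == set0] =
    [set z in [:: v]] :|: [set z in s1 | cut P1 z == set0].
  apply/setP => z; rewrite !inE andb_orl; congr (_ || _).
  by case: eqP => //= ->; rewrite cutv eqxx.
have -> : [set z in A | cut P1 z != set0] = [set z in s1 | cut P1 z != set0].
  apply/setP => z; rewrite !inE andb_orl.
  by case: eqP => //= ->; rewrite cutv eqxx andbF.
by rewrite mulrACA.
Qed.

(** Classification by the element after [v] in its block, as in [subst_T_word]. It exists because
    the block ends at [x]; the value i = [size s] is the case where it is [x]. *)
Lemma closed_sum_cons V v s x : pairwise rlt (V ++ rcons (v :: s) x) ->
  closed_sum V (v :: s) x = \sum_(i < (size s).+1)
    open_sum [:: v] (take i s) * closed_sum (rcons V v) (drop i s) x.
Proof.
move=> pw; transitivity (\sum_(i < (size s).+1) \sum_(P |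
    (ncpart [set z in V ++ rcons (v :: s) x] P && in_block P V v x)
      && joined_off P v (head x (drop i s)) (take i s))
    (\prod_(B in P) F B) *
    \prod_(B in preim_partition (cut P) [set z in v :: s]) G B); last first.
  apply: eq_bigr => i _.
  by have := @closed_sum_split V v (take i s) (drop i s) x; rewrite cat_take_drop => <-.
apply: sum_unique => P /andP[/andP[pP _] /exists_inP[B PB /and3P[VB vB xB]]].
have hasB : has (mem B) (rcons s x).
  by apply/hasP; exists x; rewrite // mem_rcons mem_head.
have hdE k : head x (drop k s) = nth x (rcons s x) k.
  rewrite -nth0 nth_drop addn0 nth_rcons; case: ltnP => // le.
  by rewrite nth_default // if_same.
pose m := find (mem B) (rcons s x).
have ltm : (m < (size s).+1)%N by rewrite -(size_rcons s x) -has_find.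
exists (Ordinal ltm) => k.
apply/exists_inP/eqP => [[D PD /and3P[vD kD dD]]|->].
  have DB := block_eq pP PD PB vD vB; rewrite DB hdE in kD dD.
  apply/eqP; rewrite -val_eqE eqn_leq /=; apply/andP; split; last first.
    by rewrite leqNgt; apply/negP => /(before_find x); rewrite /= kD.
  rewrite leqNgt; apply/negP => lt.
  have := nth_find x hasB; rewrite -/m /= => mB.
  have ltms : (m < size s)%N by apply: leq_trans lt _; rewrite -ltnS.
  rewrite nth_rcons ltms in mB.
  have := disjointFr dD mB; rewrite -(nth_take x lt) mem_nth //.
  by rewrite size_take_min leq_min lt.
have mB : nth x (rcons s x) m \in B := nth_find x hasB.
exists B => //; rewrite vB hdE /= mB /=.
apply/pred0P => z /=; apply/negbTE/negP => /andP[zB /(nthP x)[j]].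
rewrite size_take_min leq_min => /andP[ltj ltjs]; rewrite nth_take // => zE.
by have := before_find x ltj; rewrite nth_rcons ltjs zE /= zB.
Qed.

(** Intervals are taken among the letters of [s], so that a suffix of the word leads to a sum of the
    same kind. *)
Definition intpart s : pred {set {set T}} := fun P => partition P [set x in s] &&
  [forall B in P, forall a in B, forall c in B, forall b,
     [&& b \in s, rlt a b & rlt b c] ==> (b \in B)].

Lemma intpartP s P : reflect (partition P [set x in s] /\ forall B a b c, B \in P ->
    a \in B -> c \in B -> b \in s -> rlt a b -> rlt b c -> b \in B)
  (intpart s P).
Proof.
apply: (iffP andP) => -[pP h]; split=> //.
  move=> B a b c PB aB cB bs ab bc.
  move: h => /forall_inP/(_ B PB)/forall_inP/(_ a aB)/forall_inP/(_ c cB)/forallP/(_ b).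
  by rewrite bs ab bc.
apply/forall_inP => B PB; apply/forall_inP => a aB; apply/forall_inP => c cB.
apply/forallP => b; apply/implyP => /and3P[bs ab bc]; exact: (h B a b c).
Qed.

Definition int_sum s : R := \sum_(P | intpart s P) \prod_(B in P) F B.

Lemma int_sum_nil : int_sum [::] = 1.
Proof.
rewrite /int_sum (big_pred1 set0) ?big_set0 // => P /=.
rewrite /intpart (_ : [set x in [::]] = set0); last by apply/setP => x; rewrite !inE.
rewrite partition_set0; case: eqP => [->|] //=.
by apply/forall_inP => B; rewrite inE.
Qed.

Lemma int_sum_split s1 s2 : s1 != [::] -> pairwise rlt (s1 ++ s2) ->
  \sum_(P | intpart (s1 ++ s2) P && ([set x in s1] \in P)) \prod_(B in P) F B
  = F [set x in s1] * int_sum s2.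
Proof.
move=> s10; rewrite pairwise_cat => /and3P[/allrelP lt12 _ _].
pose X1 := [set x in s1]; pose X2 := [set x in s2].
have EX : [set x in s1 ++ s2] = X1 :|: X2 by apply/setP => x; rewrite !inE mem_cat.
have dX : [disjoint X1 & X2].
  apply/pred0P => x /=; apply/negbTE/negP => /andP[]; rewrite !inE => x1 x2.
  by have := lt12 x x x1 x2; rewrite /rlt ltnn.
have X10 : X1 != set0.
  by case: (s1) s10 @X1 EX dX => // x s _ X1 _ _; apply/set0Pn; exists x; rewrite inE mem_head.
have p1 : partition [set X1] X1.
  apply/and3P; split; first by rewrite /cover big_set1.
    by apply/trivIsetP => B D /set1P -> /set1P ->; rewrite eqxx.
  by rewrite inE eq_sym.
transitivity ((\sum_(P | P == [set X1]) \prod_(B in P) F B) * int_sum s2); last first.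
  by rewrite big_pred1_eq big_set1.
apply: (sum_split_prod dX).
- move=> P /andP[/intpartP[pP _] PX1]; rewrite EX in pP; split=> // B PB.
  have [->|neB] := eqVneq B X1; [by left | right].
  apply/subsetP => z zB; have := subsetP (block_sub pP PB) z zB.
  rewrite inE => /orP[z1|//]; case/eqP: neB; exact: block_eq pP PB PX1 zB z1.
- by move=> P /eqP ->.
- by move=> P /intpartP[].
- move=> P1 P2 q1 q2; have pU := partitionU dX q1 q2.
  apply/andP/andP => [[/intpartP[_ h] PX1]|[/eqP E1 /intpartP[_ h]]].
    have {}PX1 : X1 \in P1.
      move: PX1; rewrite inE => /orP[//|/(block_sub q2) X12].
      have /set0Pn[x x1] := X10.
      by have := subsetP X12 x x1; rewrite (disjointFr dX x1).
    split.
      apply/eqP/setP => B; rewrite inE; apply/idP/eqP => [PB|-> //].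
      have /set0Pn[x xB] := block_neq0 q1 PB.
      exact: block_eq q1 PB PX1 xB (subsetP (block_sub q1 PB) x xB).
    apply/intpartP; split=> // B a b c PB aB cB b2; apply: h => //.
      by rewrite inE PB orbT.
    by rewrite mem_cat b2 orbT.
  split; last by rewrite E1 !inE eqxx.
  apply/intpartP; rewrite EX; split=> // B a b c; rewrite inE E1 inE.
  move=> /orP[/eqP ->|PB] aB cB; rewrite mem_cat => /orP[b1|b2] ab bc.
  - by rewrite inE.
  - rewrite inE in cB; have := lt12 c b cB b2.
    by rewrite /rlt => /ltnW; rewrite leqNgt => /negP; case.
  - have := subsetP (block_sub q2 PB) a aB; rewrite inE => a2.
    have := lt12 b a b1 a2.
    by rewrite /rlt => /ltnW; rewrite leqNgt => /negP; case.
  exact: h PB aB cB b2 ab bc.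
by move=> P1 P2 /eqP -> /intpartP[q2 _]; exact: prod_partitionU dX p1 q2.
Qed.

Lemma take_neq0 (k : nat) s : s != [::] -> take k.+1 s != [::].
Proof. by case: s. Qed.

Lemma int_sum_cons s : s != [::] -> pairwise rlt s ->
  int_sum s = \sum_(i < size s) F [set x in take i.+1 s] * int_sum (drop i.+1 s).
Proof.
move=> s0 pw; have us : uniq s.
  by apply: pairwise_uniq pw => x; rewrite /rlt ltnn.
transitivity (\sum_(i < size s) \sum_(P | intpart s P && ([set x in take i.+1 s] \in P))
  \prod_(B in P) F B); last first.
  by apply: eq_bigr => i _; rewrite -int_sum_split ?cat_take_drop ?take_neq0.
apply: sum_unique => P /intpartP[pP h].
have [x0 [s' sE]] : exists x s', s = x :: s' by case: (s) s0 => // x s' _; exists x, s'.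
have s_gt0 : (0 < size s)%N by rewrite sE.
have : x0 \in cover P by have /and3P[/eqP -> _ _] := pP; rewrite inE sE mem_head.
case/bigcupP => B PB hB.
have n0 : nth x0 s 0%N = x0 by rewrite sE.
have h0 : nth x0 s (Ordinal s_gt0) \in B by rewrite /= n0.
exists [arg max_(i > Ordinal s_gt0 | nth x0 s i \in B) i].
case: arg_maxnP => // j jB jmax k.
have lt_nth i1 i2 : (i1 < i2 < size s)%N -> rlt (nth x0 s i1) (nth x0 s i2).
  move=> /andP[lt12 lt2]; move/(pairwiseP x0): pw; apply; rewrite ?inE //.
  exact: ltn_trans lt12 lt2.
have BE : B = [set x in take j.+1 s].
  apply/setP => z; rewrite inE; apply/idP/(nthP x0) => [zB|[ i ]].
    have := subsetP (block_sub pP PB) z zB; rewrite inE => /(nthP x0)[i lti zE].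
    have lij : (i <= j)%N by apply: (jmax (Ordinal lti)); rewrite /= zE.
    by exists i; rewrite ?nth_take // size_take_min leq_min ltnS lij lti.
  rewrite size_take_min leq_min ltnS => /andP[lij lti] <-; rewrite nth_take //.
  case: (posnP i) => [->|i_gt0]; first by rewrite n0.
  move: lij; rewrite leq_eqVlt => /orP[/eqP -> //|lij].
  apply: (h B x0 _ (nth x0 s j)) => //; first exact: mem_nth.
    by rewrite -[x0 in rlt x0 _]n0; apply: lt_nth; rewrite i_gt0.
  by apply: lt_nth; rewrite lij /=.
apply/idP/eqP => [PK|->]; last by rewrite -BE.
have : [set x in take k.+1 s] = [set x in take j.+1 s].
  rewrite -BE; apply: block_eq pP PK PB _ hB.
  by rewrite inE; move: (nat_of_ord k) => k'; rewrite sE mem_head.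
move=> /(congr1 (fun X : {set T} => #|X|)).
rewrite !cardsE !(card_uniqP _) ?take_uniq // !size_takel // => -[] kj.
exact: val_inj.
Qed.

End Noncrossing.

(** * Partition sums as coefficients of formal series *)

Section Match.
Variables (R : comNzRingType) (T T' : finType) (r : T -> nat) (e : T -> T').
Hypothesis r_inj : injective r.
Variables (a b : ncs R T') (F G : {set T} -> R).
Hypothesis FE : forall V, V != [::] -> pairwise (rlt r) V -> F [set x in V] = a (map e V).
Hypothesis GE : forall V, V != [::] -> pairwise (rlt r) V -> G [set x in V] = b (map e V).

(** The two recursions call each other, hence one induction on length. Reading W replaces b by its
    quotient by W; a block that has read V and must end at x corresponds to the quotient of a by V
    on the left and x on the right. [W ++ s] is nonempty because nothing is assumed about
    [G set0]. *)
Lemma open_closed_sums_subst n s W V x : (size s <= n)%N ->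
  (W ++ s != [::] -> pairwise (rlt r) (W ++ s) ->
     open_sum r F G W s = subst (star_U a b) (lshift (map e W) b) (map e s)) /\
  (pairwise (rlt r) (V ++ rcons s x) ->
     closed_sum r F G V s x =
       subst (star_T a b) (lshift (map e V) (dr (e x) a)) (map e s)).
Proof.
elim: n s W V x => [|n IH] s W V x.
  rewrite leqn0 size_eq0 => /eqP ->; rewrite !cats0 cats1; split=> [W0 pw|pw].
    by rewrite open_sum_nil GE // subst_nil ?/lshift ?cats0 // => y; apply: star_U0.
  rewrite closed_sum_nil FE //; last by rewrite -size_eq0 size_rcons.
  rewrite subst_nil; last by move=> y; apply: star_T0.
  by rewrite /lshift /dr cats0 map_rcons.
move=> les; have [s0|s0] := eqVneq s [::].
  by have := IH [::] W V x isT; rewrite s0.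
split=> [_|] pw.
  have pws : pairwise (rlt r) s by move: pw; rewrite pairwise_cat => /and3P[].
  rewrite (open_sum_cons r_inj F G W x s0 pws).
  rewrite (subst_U_word _ _ _ (e x)); last by rewrite -size_eq0 size_map size_eq0.
  rewrite size_map; apply: eq_bigr => i _.
  rewrite (nth_map x) // -map_take -map_drop dl_lshift -map_rcons.
  have sE : s = take i s ++ nth x s i :: drop i.+1 s.
    by rewrite -drop_nth // cat_take_drop.
  have lt1 : (size (take i s) <= n)%N.
    by rewrite size_take ltn_ord -ltnS (leq_trans (ltn_ord i)).
  have lt2 : (size (drop i.+1 s) <= n)%N.
    by rewrite size_drop; have := ltn_ord i; move: les; lia.
  have [_ ->] := IH _ [::] [::] (nth x s i) lt1; last first.
    rewrite /= -take_nth //; move: pws; rewrite -{1}(cat_take_drop i.+1 s).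
    by rewrite pairwise_cat => /and3P[].
  have [-> //] := IH _ (rcons W (nth x s i)) V x lt2.
  - by rewrite star_uE.
  - by rewrite -size_eq0 size_cat size_rcons.
  move: pw; rewrite cat_rcons {1}sE !pairwise_cat allrel_catr => /and3P[/andP[_ ->] ->].
  by case/and3P.
case: s s0 les pw => [//|v s] _ les pw.
rewrite (closed_sum_cons r_inj) // map_cons subst_T_word size_map.
apply: eq_bigr => i _; rewrite -map_take -map_drop dl_lshift -map_rcons.
move: pw; rewrite rcons_cons -cat_rcons -{1}(cat_take_drop i s) rcons_cat => pw.
have lt1 : (size (take i s) <= n)%N.
  by rewrite size_take_min; move: les => /=; lia.
have lt2 : (size (drop i s) <= n)%N.
  by rewrite size_drop; move: les => /=; lia.
have [-> //] := IH _ [:: v] V x lt1.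
  have [_ -> //] := IH _ W (rcons V v) x lt2.
  move: pw; rewrite !pairwise_cat allrel_catr => /and3P[/andP[_ ->] -> /and3P[]] //.
move: pw; rewrite -cats1 !pairwise_cat allrel_catr !allrel_catl.
by move=> /and3P[/andP[/andP[_ ->] _] /and3P[_ _ ->] /and3P[_ -> _]].
Qed.

Lemma star_sum s : s != [::] -> pairwise (rlt r) s ->
  \sum_(P | ncpart r [set x in s] P) (\prod_(B in P) F B) *
     \prod_(B in preim_partition (cut r P) [set x in s]) G B = nc_star a b (map e s).
Proof.
move=> s0 pw; have [x _] : exists x : T, True by case: (s) s0 => // x; exists x.
have [E _] := open_closed_sums_subst [::] [::] x (leqnn (size s)).
rewrite /nc_star (_ : b = lshift [::] b) // -E //.
apply: eq_bigr => P /andP[pP _]; congr (_ * _).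
have [s' [y sE]] : exists s' y, s = rcons s' y.
  by case/lastP: (s) s0 => // s' y _; exists s', y.
(* The last bar separates no pair, so the open block is a genuine complement block: the fibre of the
   empty cut. *)
have cuty : cut r P y = set0.
  apply: (cut0_ge pP) => q; rewrite sE inE mem_rcons in_cons => /orP[/eqP -> //|q1].
  move: pw; rewrite sE -cats1 pairwise_cat => /andP[/allrelP lt _].
  by apply/ltnW/lt; rewrite ?mem_head.
rewrite (@prod_preim_fibre _ _ _ G (cut r P) _ y); last by rewrite inE sE mem_rcons mem_head.
rewrite cuty; congr (G _ * _); first by apply/setP => z; rewrite !inE.
suff -> : [set z in [set x in s] | cut r P z != set0] =
  [set z in s | cut r P z != set0] by [].
by apply/setP => z; rewrite !inE.
Qed.

Lemma int_sum_nc_int s : a [::] = 0 -> pairwise (rlt r) s ->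
  int_sum r F s = nc_int a (map e s).
Proof.
move=> a0; have [n] := ubnP (size s); elim: n s => // n IH s les pw.
rewrite nc_intE // ncsDE ncsM0E //.
have [->|s0] := eqVneq s [::]; first by rewrite int_sum_nil big_ord0 addr0.
rewrite (int_sum_cons F s0 pw) ncs1E (_ : cst 1 (map e s) = 0) ?add0r; last by case: (s) s0.
rewrite size_map; apply: eq_bigr => i _; rewrite -map_take -map_drop.
have : pairwise (rlt r) (take i.+1 s ++ drop i.+1 s) by rewrite cat_take_drop.
rewrite pairwise_cat => /and3P[_ pw1 pw2].
rewrite FE ?take_neq0 //.
by rewrite IH // size_drop; have := ltn_ord i; move: les; lia.
Qed.

End Match.

(** * The Kreweras complement *)

Section Kreweras.
Variable n : nat.
Implicit Types (P Q L : {set {set 'I_n}}) (i j p q : 'I_n).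

Let rk : 'I_n -> nat := val.

Lemma refines_eq P Q : partition P [set: 'I_n] -> partition Q [set: 'I_n] ->
  refines P Q -> refines Q P -> P = Q.
Proof.
have sub P1 P2 : partition P1 [set: 'I_n] -> partition P2 [set: 'I_n] ->
    refines P1 P2 -> refines P2 P1 -> P1 \subset P2.
  move=> p1 p2 r1 r2; apply/subsetP => B PB.
  have /exists_inP[D PD BD] := forall_inP r1 B PB.
  have /exists_inP[B' PB' DB'] := forall_inP r2 D PD.
  have /set0Pn[x xB] := block_neq0 p1 PB.
  have BB' := block_eq p1 PB PB' xB (subsetP DB' x (subsetP BD x xB)).
  by rewrite (_ : B = D) //; apply/eqP; rewrite eqEsubset BD BB'.
by move=> p1 p2 r1 r2; apply/eqP; rewrite eqEsubset !sub.
Qed.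

Lemma bar_unionP P Q B : B \in bar_union P Q ->
  (exists2 V, V \in P & B = inl @: V) \/ (exists2 V, V \in Q & B = inr @: V).
Proof. by rewrite inE => /orP[] /imsetP[V PV ->]; [left|right]; exists V. Qed.

Lemma mem_inl P Q V : V \in P -> inl @: V \in bar_union P Q.
Proof. by move=> PV; rewrite inE imset_f. Qed.

Lemma mem_inr P Q V : V \in Q -> inr @: V \in bar_union P Q.
Proof. by move=> QV; rewrite inE imset_f ?orbT. Qed.

Lemma cut_kernel Q i j x : x \in preim_partition (cut rk Q) [set: 'I_n] ->
  i \in x -> j \in x -> cut rk Q i = cut rk Q j.
Proof. by move=> /imsetP[k _ ->]; rewrite !inE /= => /eqP <- /eqP. Qed.

(** Two plain blocks do not cross because [Q] is non-crossing. A plain and a barred block do not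
    either: a related pair around one bar of a block is around all of them. *)
Lemma kreweras_compatible_cut Q : noncrossing (rlt rk) Q ->
  kreweras_compatible Q (preim_partition (cut rk Q) [set: 'I_n]).
Proof.
move=> nc; apply/andP; split; first exact: preim_partitionP.
apply/(@noncrossingP _ (@bar_pos n)) => B D a b c d.
have blk V p q i : V \in Q -> p \in V -> q \in V -> (p <= i < q)%N -> (p, q) \in cut rk Q i.
  by move=> QV pV qV pq; apply/cutP; split=> //; exists V; rewrite ?pV.
case/bar_unionP=> -[V QV ->] /bar_unionP[] [W QW ->] neq /imsetP[p pV ->]
  /imsetP[i iW ->] /imsetP[q qV ->] /imsetP[j jW ->]; apply/negP;
  rewrite /rlt /= => /and3P[h1 h2 h3].
- move: neq; rewrite (inj_eq (imset_inj _)) => [neq|? ? []//].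
  have := noncrossingP rk Q nc V W p i q j QV QW neq pV iW qV jW.
  by rewrite /rlt /rk /=; move: h1 h2 h3; rewrite !ltn_double => -> -> ->.
- have pqi : (p, q) \in cut rk Q i by apply: blk QV pV qV _; move: h1 h2; lia.
  rewrite (cut_kernel QW iW jW) in pqi; move/cutP: pqi => [+ _]; rewrite /rk /=.
  by move: h3; lia.
- have ijp : (i, j) \in cut rk Q q by apply: blk QW iW jW _; move: h2 h3; lia.
  rewrite -(cut_kernel QV pV qV) in ijp; move/cutP: ijp => [+ _]; rewrite /rk /=.
  by move: h1; lia.
(* Bars p < i < q < j with p, q in V and i, j in W: a pair around bars p and q is around bar i, and
   a pair around bars i and j is around bar q. So all four cuts coincide. *)
move: neq; apply/negP; rewrite negbK; apply/eqP; congr (_ @: _).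
have pL := preim_partitionP (cut rk Q) [set: 'I_n].
suff iV : i \in V by rewrite (block_eq pL QW QV iW iV).
move/imsetP: (QV) => [k _ VE]; rewrite VE !inE /=.
have <- : cut rk Q p = cut rk Q k by apply: (cut_kernel QV pV); rewrite VE !inE eqxx.
have pq := cut_kernel QV pV qV; have ij := cut_kernel QW iW jW.
apply/eqP/setP => -[u v]; apply/idP/idP => uv.
  have := uv; rewrite pq => /cutP[uv2 [A QA /andP[uA vA]]].
  move/cutP: uv => [uv1 _]; apply: blk QA uA vA _.
  by move: uv1 uv2 h1 h2 h3; rewrite /rk /=; lia.
have := uv; rewrite ij => /cutP[uv2 [A QA /andP[uA vA]]].
move/cutP: uv => [uv1 _]; rewrite pq; apply: blk QA uA vA _.
by move: uv1 uv2 h1 h2 h3; rewrite /rk /=; lia.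
Qed.

(** If bars i < j of one block of [L] disagree on a related pair p, q, the pair and the two bars
    alternate, as p, i, q, j or as i, p, j, q. *)
Lemma kreweras_compatible_refines Q L : partition Q [set: 'I_n] ->
  kreweras_compatible Q L ->
  refines L (preim_partition (cut rk Q) [set: 'I_n]).
Proof.
move=> pQ /andP[pL /(@noncrossingP _ (@bar_pos n)) nc].
have key V i j : V \in L -> i \in V -> j \in V -> (i < j)%N -> cut rk Q i = cut rk Q j.
  move=> LV iV jV ij; apply/setP => -[p q].
  have neq A B : @inl 'I_n 'I_n @: A = @inr 'I_n 'I_n @: B -> p \in A -> False.
    move=> E pA; have : inl p \in @inl 'I_n 'I_n @: A by apply/imsetP; exists p.
    by rewrite E => /imsetP[].
  apply/cutP/cutP => -[h [B QB /andP[pB qB]]]; split; try by exists B; rewrite ?pB.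
    apply/negPn/negP => h'.
    have := nc (inl @: B) (inr @: V) (inl p) (inr i) (inl q) (inr j)
      (mem_inl _ QB) (mem_inr _ LV) _
      (imset_f _ pB) (imset_f _ iV) (imset_f _ qB) (imset_f _ jV).
    move=> /(_ _)/negP; apply; last first.
      by rewrite /rlt /=; move: h h' ij; rewrite /rk /=; lia.
    by apply/eqP => /neq; apply.
  apply/negPn/negP => h'.
  have := nc (inr @: V) (inl @: B) (inr i) (inl p) (inr j) (inl q)
    (mem_inr _ LV) (mem_inl _ QB) _
    (imset_f _ iV) (imset_f _ pB) (imset_f _ jV) (imset_f _ qB).
  move=> /(_ _)/negP; apply; last first.
    by rewrite /rlt /=; move: h h' ij; rewrite /rk /=; lia.
  by apply/eqP => /esym/neq; apply.
apply/forall_inP => V LV; have /set0Pn[i iV] := block_neq0 pL LV.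
apply/exists_inP; exists [set j in [set: 'I_n] | cut rk Q i == cut rk Q j].
  by apply: imset_f; rewrite inE.
apply/subsetP => j jV; rewrite !inE /=; apply/eqP.
case: (ltngtP i j) => [ij|ji|/val_inj -> //]; first exact: key LV iV jV ij.
by apply/esym; apply: key LV jV iV ji.
Qed.

Lemma K_NC_cut Q : Q \in NC n ->
  K_NC Q = preim_partition (cut rk Q) [set: 'I_n].
Proof.
rewrite inE => /andP[pQ nc]; rewrite /K_NC.
have compat := kreweras_compatible_cut nc.
have max L := @kreweras_compatible_refines Q L pQ.
case: pickP => [L /andP[cL /forallP Lmax]|/(_ (preim_partition (cut rk Q) setT))]; last first.
  by rewrite compat /= => /forallP[] L; apply/implyP => /max.
apply: refines_eq (max _ cL) _; first by case/andP: cL.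
  exact: preim_partitionP.
exact: (implyP (Lmax _) compat).
Qed.

End Kreweras.

(** * From the order of s_chi to ranks *)

Section Arrangement.
Variables (n : nat) (chi : n.-tuple bool).
Local Notation s := (s_seq chi).
Local Notation r := (fun i => index i s).

Lemma s_seq_uniq : uniq s.
Proof. by rewrite (perm_uniq (s_seq_perm chi)) enum_uniq. Qed.

Lemma mem_s_seq i : i \in s.
Proof. by rewrite (perm_mem (s_seq_perm chi)) mem_enum. Qed.

Lemma s_seq_set : [set i in s] = [set: 'I_n].
Proof. by apply/setP => i; rewrite !inE mem_s_seq. Qed.

Lemma rank_inj : injective r.
Proof.
move=> i j /= E; rewrite -(nth_index i (mem_s_seq i)) E.
exact: nth_index (mem_s_seq j).
Qed.

Lemma index_s_perm i : index (s_perm chi i) s = i.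
Proof.
rewrite permE (tnth_nth i) index_uniq ?s_seq_uniq //.
by rewrite (eqP (size_s_seq chi)).
Qed.

Lemma pairwise_s_seq : pairwise (rlt r) s.
Proof.
have [->//|[x0 _]] : s = [::] \/ exists x0 : 'I_n, True.
  by case: (s) => [|x s']; [left | right; exists x].
apply/(pairwiseP x0) => i j; rewrite !inE => lti ltj ij.
by rewrite /rlt !index_uniq ?s_seq_uniq.
Qed.

Lemma BNC_ncpart P : (P \in BNC chi) = ncpart r [set x in s] P.
Proof. by rewrite inE s_seq_set. Qed.

Lemma BI_intpart P : (P \in BI chi) = intpart r s P.
Proof.
rewrite inE /intpart s_seq_set; congr (_ && _); apply: eq_forallb => B.
congr (_ ==> _); apply: eq_forallb => a; congr (_ ==> _); apply: eq_forallb => c.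
by congr (_ ==> _); apply: eq_forallb => b; rewrite mem_s_seq.
Qed.

Lemma act_partition (t : 'S_n) P :
  partition (act_part t P) [set: 'I_n] = partition P [set: 'I_n].
Proof.
rewrite -(imset_partition P setT (@perm_inj _ t)); congr partition.
apply/setP => x; rewrite inE; apply/esym/imsetP; exists ((t^-1)%g x); rewrite ?inE //.
by rewrite permKV.
Qed.

Lemma s_permV j : ((s_perm chi)^-1%g j : nat) = index j s.
Proof. by rewrite -{2}[j](permKV (s_perm chi)) index_s_perm. Qed.

Lemma act_NC P : P \in BNC chi -> act_part (s_perm chi)^-1%g P \in NC n.
Proof.
rewrite BNC_ncpart inE s_seq_set act_partition => /andP[-> nc] /=.
apply/(noncrossingP val) => _ _ a b c d /imsetP[B PB ->] /imsetP[D PD ->] neq.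
move=> /imsetP[a' aB ->] /imsetP[b' bD ->] /imsetP[c' cB ->] /imsetP[d' dD ->].
rewrite /rlt /= !s_permV; apply: (noncrossingP r P nc B D) => //.
by apply: contraNneq neq => ->.
Qed.

(** [s_perm] carries the usual order to that of [s], hence cuts to cuts; the permutation disappears
    from the complement. *)
Lemma K_BNC_cut P : P \in BNC chi ->
  K_BNC chi P = preim_partition (cut r P) [set: 'I_n].
Proof.
move=> PB; rewrite /K_BNC K_NC_cut ?act_NC //.
set t := s_perm chi; set Q := act_part t^-1%g P.
have cutQ i p q : ((p, q) \in cut val Q i) = ((t p, t q) \in cut r P (t i)).
  apply/cutP/cutP; rewrite !index_s_perm => -[h [B QB /andP[pB qB]]]; split=> //.
    case/imsetP: QB pB qB => D PD -> /imsetP[p' p'D ->] /imsetP[q' q'D ->].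
    by exists D => //; rewrite !permKV p'D.
  exists [set t^-1%g i | i in B]; first exact: imset_f.
  by rewrite -[p](permK t) -[q](permK t) !imset_f.
have kerQ i j : (cut val Q i == cut val Q j) = (cut r P (t i) == cut r P (t j)).
  apply/eqP/eqP => E; apply/setP => -[p q]; last by rewrite !cutQ E.
  by rewrite -[p](permKV t) -[q](permKV t) -!cutQ E.
apply/setP => V; apply/imsetP/imsetP => [[_ /imsetP[i _ ->] ->]|[x _ ->]].
  exists (t i) => //; apply/setP => y; rewrite !inE /=.
  rewrite -[y](permKV t) -kerQ mem_imset ?inE //; exact: perm_inj.
exists [set j in setT | cut val Q (t^-1%g x) == cut val Q j].
  by apply/imsetP; exists (t^-1%g x).
apply/setP => y; rewrite !inE /=.
by rewrite -{2}[y](permKV t) mem_imset ?inE; [rewrite kerQ !permKV | exact: perm_inj].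
Qed.

End Arrangement.

Lemma sorted_ltn_ord_inj n (t1 t2 : seq 'I_n) :
  sorted (fun i j : 'I_n => (i < j)%N) t1 -> sorted (fun i j : 'I_n => (i < j)%N) t2 ->
  t1 =i t2 -> t1 = t2.
Proof.
apply: irr_sorted_eq => [i j k|i]; [exact: ltn_trans | exact: ltnn].
Qed.

Lemma sorted_enum_ord n (V : {set 'I_n}) : sorted (fun i j : 'I_n => (i < j)%N) (enum V).
Proof.
rewrite /enum_mem; apply: sorted_filter => [i j k|]; first exact: ltn_trans.
rewrite -(@sorted_map _ _ (@nat_of_ord n) ltn).
by rewrite -enumT val_enum_ord iota_ltn_sorted.
Qed.

Lemma enum_imset_incr m n (e : 'I_m -> 'I_n) (B : {set 'I_m}) :
  (forall i j : 'I_m, (i < j)%N -> (e i < e j)%N) -> enum (e @: B) = map e (enum B).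
Proof.
move=> incr; apply: sorted_ltn_ord_inj; first exact: sorted_enum_ord.
  rewrite sorted_map; apply: sub_sorted (sorted_enum_ord B) => i j; exact: incr.
move=> x; rewrite mem_enum; apply/imsetP/mapP => -[i iB ->]; exists i => //.
  by rewrite mem_enum.
by rewrite -mem_enum.
Qed.

Section Restriction.
Variables (n : nat) (V : {set 'I_n}).
Local Notation e := (@enum_val _ (mem V)).

Lemma enum_val_incr (i j : 'I_#|V|) : (i < j)%N -> (e i < e j)%N.
Proof.
move=> ij; have x0 : 'I_n by exact: e i.
rewrite (enum_val_nth x0 i) (enum_val_nth x0 j).
have := sorted_enum_ord V; rewrite (sorted_pairwise); last by move=> ? ? ?; apply: ltn_trans.
move=> /(pairwiseP x0); apply=> //; by rewrite inE -cardE.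
Qed.

Lemma imset_enum_val : e @: [set: 'I_#|V|] = V.
Proof.
apply/setP => x; apply/imsetP/idP => [[i _ ->]|xV]; first exact: enum_valP.
by exists (enum_rank_in xV x); rewrite ?enum_rankK_in.
Qed.

Lemma map_enum_val : map e (enum 'I_#|V|) = enum V.
Proof.
rewrite -[in RHS]imset_enum_val enum_imset_incr; last exact: enum_val_incr.
by rewrite enum_setT enumT.
Qed.

(** [enum_val] is increasing, so it respects both the left letters in order and the right letters
    reversed: listing by s_chi commutes with restriction. *)
Lemma map_s_seq_restr (chi : n.-tuple bool) :
  map e (s_seq (restr V chi)) = [seq x <- s_seq chi | x \in V].
Proof.
have E c : map e [seq i <- enum 'I_#|V| | tnth (restr V chi) i == c] =
    [seq x <- [seq i <- enum 'I_n | tnth chi i == c] | x \in V].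
  rewrite (eq_filter (a2 := preim e (fun x => tnth chi x == c))); last first.
    by move=> i; rewrite /= tnth_mktuple.
  rewrite -filter_map map_enum_val [in LHS]/enum_mem -enumT -!filter_predI.
  by apply: eq_filter => i; congr (_ && _); exact: andbC.
by rewrite /s_seq map_cat map_rev !E filter_cat filter_rev.
Qed.

End Restriction.

(** * Series over the positions of a word *)

Section Locality.
Variables (R : comNzRingType) (T : finType) (r : T -> nat) (s : seq T).
Hypotheses (r_inj : injective r) (s_full : forall x, x \in s).
Hypothesis s_sorted : pairwise (rlt r) s.

Lemma filter_sorted_word (V : seq T) : pairwise (rlt r) V ->
  [seq x <- s | x \in [set y in V]] = V.
Proof.
have tr : transitive (rlt r) by move=> x y z; apply: ltn_trans.
move=> pw; apply: (irr_sorted_eq tr (fun x => ltnn (r x))).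
- by apply: (sorted_filter tr); rewrite sorted_pairwise.
- by rewrite sorted_pairwise.
by move=> x; rewrite mem_filter s_full andbT inE.
Qed.

(** [star_sum] expresses the coefficient at [v] through blocks of partitions of its letters, and
    sorted blocks are subsequences of [s]. *)
Lemma nc_star_local (a a' b b' : ncs R T) v :
  (forall u, subseq u s -> u != [::] -> a u = a' u) ->
  (forall u, subseq u s -> u != [::] -> b u = b' u) ->
  subseq v s -> v != [::] -> nc_star a b v = nc_star a' b' v.
Proof.
move=> aa bb vs v0.
(* Listing a block in the order of [s] turns a series into a function of sets, as [star_sum]
   requires. *)
pose W (c : ncs R T) (B : {set T}) := c [seq x <- s | x \in B].
have WE c V : V != [::] -> pairwise (rlt r) V -> W c [set x in V] = c (map id V).
  by move=> _ pw; rewrite /W filter_sorted_word // map_id.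
have pwv : pairwise (rlt r) v := subseq_pairwise vs s_sorted.
have WB c c' B : (forall u, subseq u s -> u != [::] -> c u = c' u) ->
    B != set0 -> W c B = W c' B.
  move=> cc /set0Pn[x xB]; apply: cc; first exact: filter_subseq.
  by rewrite -has_filter; apply/hasP; exists x.
rewrite -[v]map_id -!(star_sum r_inj (WE _) (WE _) v0 pwv).
apply: eq_bigr => P /andP[pP _]; congr (_ * _).
  by apply: eq_bigr => B PB; apply: WB (block_neq0 pP PB).
apply: eq_bigr => B PB.
exact: WB (block_neq0 (preim_partitionP (cut r P) [set x in v]) PB).
Qed.

End Locality.

Section Words.
Variables (R : comNzRingType) (I J : choiceType).
Local Notation K := (I + J)%type.
Implicit Types f g : series0 R K.

(* Letters are positions in the word [w]: a set of positions stands for the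
   subword of [w] it carries, whatever the order in which it is listed. *)
Definition word_ncs n (w : n.-tuple K) f : ncs R 'I_n :=
  fun v => coef f [seq tnth w i | i <- enum [set i in v]].

Section FixedWord.
Variables (n : nat) (w : n.-tuple K).
Local Notation s := (s_seq (chi_of w)).

Lemma word_ncs_nil f : word_ncs w f [::] = 0.
Proof.
by rewrite /word_ncs (_ : [set i in [::]] = set0) ?enum_set0 ?coef_nil //.
Qed.

Lemma word_ncs_restr f (V : {set 'I_n}) :
  word_ncs w f [seq x <- s | x \in V] = Cf f (restr V w).
Proof.
rewrite /word_ncs (_ : [set i in _] = V); last first.
  by apply/setP => x; rewrite inE mem_filter mem_s_seq andbT.
by rewrite /Cf /restr /= -map_enum_val -map_comp.
Qed.

Lemma subseq_s_seq v : subseq v s -> v = [seq x <- s | x \in [set y in v]].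
Proof.
move=> vs; rewrite {1}(subseq_uniqP (s_seq_uniq _) vs).
by apply: eq_filter => x; rewrite inE.
Qed.

Lemma word_ncs_full f : word_ncs w f s = Cf f w.
Proof.
rewrite -(restr_full (fun k (_ : k.-tuple unit) (x : k.-tuple K) => Cf f x)
  (nseq_tuple n tt) w).
by rewrite -word_ncs_restr (eq_filter (a2 := predT)) ?filter_predT // => x; rewrite inE.
Qed.

End FixedWord.

Section SubWord.
Variables (n : nat) (w : n.-tuple K) (V : {set 'I_n}).
Hypothesis V0 : V != set0.
Local Notation e := (@enum_val _ (mem V)).
Local Notation chi := (chi_of (restr V w)).
Local Notation s := (s_seq chi).
Local Notation r := (fun i => index i s).

Lemma chi_of_restr : chi = restr V (chi_of w).
Proof. by apply: eq_from_tnth => i; rewrite !(tnth_map, tnth_mktuple). Qed.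

Lemma map_enum_val_s_seq : map e s = [seq x <- s_seq (chi_of w) | x \in V].
Proof. by rewrite chi_of_restr map_s_seq_restr. Qed.

Lemma s_seq_restr_neq0 : s != [::].
Proof.
case/set0Pn: V0 => x xV; apply/negP => /eqP E.
by have := mem_s_seq chi (enum_rank_in xV x); rewrite E.
Qed.

Lemma Cf_restr f (U : seq 'I_#|V|) :
  Cf f (restr [set x in U] (restr V w)) = word_ncs w f (map e U).
Proof.
rewrite /Cf /word_ncs; congr coef.
rewrite (_ : [set i in map e U] = e @: [set x in U]); last first.
  apply/setP => x; rewrite inE; apply/mapP/imsetP => -[i iU ->]; exists i => //.
    by rewrite inE.
  by move: iU; rewrite inE.
rewrite enum_imset_incr -?map_comp; last exact: enum_val_incr.
rewrite -(map_enum_val [set x in U]) -map_comp /=.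
by apply: eq_map => i /=; rewrite tnth_mktuple.
Qed.

(** The defining sum of the product is taken at the restricted word, and [enum_val] carries its
    positions to those of [w]. *)
Lemma star_subword f g : word_ncs w (star f g) (map e s) =
  nc_star (word_ncs w f) (word_ncs w g) (map e s).
Proof.
rewrite {1}map_enum_val_s_seq word_ncs_restr Cf_series_of; last by rewrite card_gt0.
apply: etrans (star_sum (@rank_inj _ chi) (fun U _ _ => Cf_restr f U)
  (fun U _ _ => Cf_restr g U) s_seq_restr_neq0 (pairwise_s_seq _)).
under eq_bigl => P do rewrite BNC_ncpart.
apply: eq_bigr => P; rewrite -BNC_ncpart => PB; congr (_ * _).
by rewrite /Cf_part K_BNC_cut // s_seq_set.
Qed.

Lemma moment_cumulants (S : forall k, k.-tuple bool -> {set {set {set 'I_k}}})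
    (mu : distribution R K) kappa m (alpha : m.-tuple K) :
  (forall k (c : k.-tuple bool) P, P \in S _ c -> partition P [set: 'I_k]) ->
  is_cumulants S mu kappa -> (0 < m)%N ->
  mu (\prod_(i < m) tnth (map_tuple (@Z R K) alpha) i) =
  \sum_(P in S _ (chi_of alpha)) Cf_part (series_of (fun k (beta : k.-tuple K) =>
     kappa k (chi_of beta) (map_tuple (@Z R K) beta))) alpha P.
Proof.
move=> Sp [_ _ kE] m_gt0; rewrite (kE _ (chi_of alpha)) //.
apply: eq_bigr => P SP; apply: eq_bigr => B PB.
rewrite Cf_series_of; last by rewrite card_gt0 (block_neq0 (Sp _ _ _ SP) PB).
by rewrite /chi_of !restr_map.
Qed.

Lemma R_series_R_inv f : R_series (R_inv f) = f.
Proof. exact: (@proj2_sig _ (fun mu => R_series mu = f) _). Qed.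

(** Both sides are the moment of the subword under the distribution with R-series f: on the left
    through interval partitions, on the right through non-crossing ones with complement weight 1. *)
Lemma bReta_subword f : nc_int (word_ncs w (bReta f)) (map e s) =
  nc_moment (word_ncs w f) (map e s).
Proof.
have V_gt0 : (0 < #|V|)%N by rewrite card_gt0.
pose mu := R_inv f.
have E1 := moment_cumulants (restr V w) (@BNC_partition) (lr_cumulantsP mu) V_gt0.
have E2 := moment_cumulants (restr V w) (@BI_partition) (B_lr_cumulantsP mu) V_gt0.
rewrite E1 in E2.
rewrite -/(R_series mu) -/(eta_series mu) -/(bReta f) R_series_R_inv in E2.
have one_e : forall U : seq 'I_#|V|, U != [::] -> pairwise (rlt r) U ->
  1 = @ones R 'I_n (map e U) by [].
have star1 := star_sum (F := fun B => Cf f (restr B (restr V w)))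
  (G := fun=> 1) (@rank_inj _ chi) (fun U _ _ => Cf_restr f U) one_e
  s_seq_restr_neq0 (pairwise_s_seq _).
apply: etrans star1.
have /= <- := int_sum_nc_int (F := fun B => Cf (bReta f) (restr B (restr V w)))
  (fun U _ _ => Cf_restr (bReta f) U) (word_ncs_nil _ _) (pairwise_s_seq _).
rewrite /int_sum; transitivity (\sum_(P in BI chi) Cf_part (bReta f) (restr V w) P).
  by apply: eq_bigl => P; rewrite BI_intpart.
rewrite -E2; apply: eq_big => P; first by rewrite BNC_ncpart.
by move=> _; rewrite big1_eq mulr1.
Qed.

End SubWord.

(** * Comparison of coefficients on subsequences of the listed word *)

Section Conclusion.
Variables (n : nat) (w : n.-tuple K).
Local Notation s := (s_seq (chi_of w)).
Local Notation r := (fun i => index i s).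

Lemma subseq_restr v : subseq v s -> v != [::] ->
  exists2 V : {set 'I_n}, V != set0 &
    v = map (@enum_val _ (mem V)) (s_seq (chi_of (restr V w))).
Proof.
move=> vs v0; exists [set x in v]; last by rewrite map_enum_val_s_seq -subseq_s_seq.
by case: (v) v0 => // x u _; apply/set0Pn; exists x; rewrite inE mem_head.
Qed.

Lemma word_ncs_star f g v : subseq v s -> v != [::] ->
  word_ncs w (star f g) v = nc_star (word_ncs w f) (word_ncs w g) v.
Proof. by move=> vs v0; have [V V0 ->] := subseq_restr vs v0; apply: star_subword. Qed.

Lemma word_ncs_int f v : subseq v s ->
  nc_int (word_ncs w (bReta f)) v = nc_moment (word_ncs w f) v.
Proof.
move=> vs; have [->|v0] := eqVneq v [::].
  by rewrite nc_int_nil ?nc_moment_nil // word_ncs_nil.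
by have [V V0 ->] := subseq_restr vs v0; apply: bReta_subword.
Qed.

Lemma word_ncs_local (a a' b b' : ncs R 'I_n) v :
  (forall u, subseq u s -> u != [::] -> a u = a' u) ->
  (forall u, subseq u s -> u != [::] -> b u = b' u) ->
  subseq v s -> v != [::] -> nc_star a b v = nc_star a' b' v.
Proof.
exact: (nc_star_local (@rank_inj _ (chi_of w)) (mem_s_seq _) (pairwise_s_seq _)).
Qed.

Lemma Cf_bReta_star f g : Cf (bReta (star f g)) w = Cf (star (bReta f) (bReta g)) w.
Proof.
rewrite -!word_ncs_full; have [->|s0] := eqVneq s [::]; first by rewrite !word_ncs_nil.
(* For the product, [c] is [star f g] and [a] is the formal product, known to agree only on nonempty
   subsequences; for each factor, [a] is its own word series. *)
have eta c (a : ncs R 'I_n) :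
    (forall u, subseq u s -> u != [::] -> word_ncs w c u = a u) ->
    forall u, subseq u s -> word_ncs w (bReta c) u = nc_eta a u.
  move=> ca; apply: nc_int_eta; first exact: word_ncs_nil.
  move=> v vs; rewrite word_ncs_int //.
  have [->|v0] := eqVneq v [::]; first by rewrite !nc_moment_nil.
  exact: word_ncs_local.
rewrite (eta _ _ (word_ncs_star f g)) // word_ncs_star // nc_eta_star.
by apply: word_ncs_local => // u us _; apply/esym/eta.
Qed.

End Conclusion.

Lemma bReta_star f g : bReta (star f g) = star (bReta f) (bReta g).
Proof. by apply: series0_ext => n w _; apply: Cf_bReta_star. Qed.
End Words.

Theorem theorem7p8 (R : realType) (I J : choiceType)
    (f g : series0 R[i] (I + J)%type) :
  bReta (star f g) = star (bReta f) (bReta g).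
Proof. exact: bReta_star. Qed.
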